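(* Let $(M,g)$ be a smooth closed Riemannian $n$-manifold, $n\ge5$, and let $q,m_0,m_1>0$ and $\theta\in(0,1)$ be given. Let $2^\star=\frac{2n}{n-2}$ and let $S_g$ be the scalar curvature of $g$. Then there exists a continuous map $\bar h:\mathbb{R}\times C^{1,\theta}\to C^{0,\theta}$, $(\omega,u)\mapsto\bar h_\omega(u)$, such that: (i) $\bar h_\omega(u)>\frac{n-2}{4(n-1)}S_g$ somewhere in $M$, for all $\omega$ and all $u$; (ii) $\bar h_\omega(u)$ is nonnegative and nonzero, for all $\omega$ and all $u$; (iii) $\bar h$ is uniformly bounded in subsets $K\times C^{1,\theta}$ for $K\subset\mathbb{R}$ compact; (iv) the system $$(\mathrm{S}_\omega)\qquad\begin{cases}\Delta_gu+\bar h_\omega(u)u=u^{2^\star-1}+\omega^2(1-qv)^2u,\\ \Delta_gv+(m_1^2+q^2u^2)v=qu^2\end{cases}$$ admits at least a positive constant solution; and such that, for all $\beta\in(0,1)$, there exists $C>0$ such that for all $\omega\in\mathbb{R}$ and for any positive solution $(u,v)\in C^2$ of $(\mathrm{S}_\omega)$, we have $\|u\|_{C^{1,\beta}}+\|v\|_{C^{1,\beta}}\le C$.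
   Context: Closed means compact without boundary. $\Delta_g=-\mathrm{div}_g\nabla$ is the Laplace-Beltrami operator. $C^{k,\theta}=C^{k,\theta}(M)$ are the usual Hölder spaces of functions on $M$. A positive solution is a pair of functions $u,v>0$ in $M$ satisfying the system. *)

(* Defs.v *)
From HB Require Import structures.
From mathcomp Require Import all_boot all_order all_algebra finmap.
From mathcomp Require Import all_classical all_reals all_analysis.
Set Implicit Arguments.
Unset Strict Implicit.
Unset Printing Implicit Defensive.
Import Order.TTheory GRing.Theory Num.Theory.
Import numFieldNormedType.Exports.
Local Open Scope classical_set_scope.
Local Open Scope ring_scope.

Section Euclidean.
Context {R : realType} {n : nat}.
Implicit Types (U : set 'rV[R]_n) (f : 'rV[R]_n -> R).

Definition partial (a : 'I_n) f : 'rV[R]_n -> R :=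
  fun x => 'D_(delta_mx 0 a) f x.

(* Meant for open U, where the iterated partial derivatives only see the values
   of f on U. *)
Fixpoint Ck_on (m : nat) U f : Prop :=
  {within U, continuous f} /\
  match m with
  | 0 => True
  | m'.+1 => forall a : 'I_n,
      (forall x, U x -> derivable f x (delta_mx 0 a)) /\
      Ck_on m' U (partial a f)
  end.

Definition smooth_on U f : Prop := forall m, Ck_on m U f.

Definition sup_norm_on U f : \bar R := ereal_sup [set `|f x|%:E | x in U].

Definition holder_seminorm_on (th : R) U f : \bar R :=
  ereal_sup [set s | exists x y, [/\ U x, U y, x != y &
                       s = (`|f x - f y| / `|x - y| `^ th)%:E]].

Fixpoint holder_norm_on (m : nat) (th : R) U f : \bar R :=
  match m with
  | 0 => sup_norm_on U f + holder_seminorm_on th U f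
  | m'.+1 => sup_norm_on U f +
             \sum_(a < n) holder_norm_on m' th U (partial a f)
  end%E.

(* Operators in coordinates; G x is the matrix of the metric at x. *)
Variable G : 'rV[R]_n -> 'M[R]_n.

Definition volume_density (x : 'rV[R]_n) : R := Num.sqrt (\det (G x)).

Definition gradient_loc f (x : 'rV[R]_n) (a : 'I_n) : R :=
  \sum_(b < n) invmx (G x) a b * partial b f x.

Definition divergence_loc (X : 'rV[R]_n -> 'I_n -> R) (x : 'rV[R]_n) : R :=
  (volume_density x)^-1 *
  \sum_(a < n) partial a (fun y => volume_density y * X y a) x.

Definition christoffel (c a b : 'I_n) (x : 'rV[R]_n) : R :=
  2^-1 * \sum_(d < n) invmx (G x) c d *
    (partial a (fun y => G y b d) x + partial b (fun y => G y a d) x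
     - partial d (fun y => G y a b) x).

Definition ricci_loc (a b : 'I_n) (x : 'rV[R]_n) : R :=
  \sum_(c < n)
    (partial c (christoffel c a b) x - partial b (christoffel c a c) x
     + \sum_(d < n) (christoffel c c d x * christoffel d a b x
                     - christoffel c b d x * christoffel d a c x)).

Definition scalar_curvature_loc (x : 'rV[R]_n) : R :=
  \sum_(a < n) \sum_(b < n) invmx (G x) a b * ricci_loc a b x.

End Euclidean.

(* A smooth closed n-manifold, not assumed connected. The atlas need not be
   maximal; second countability follows from compactness. The values of a chart
   off its domain, and of its inverse off its codomain, are irrelevant. The base
   point of the carrier is arbitrary and only says that M is nonempty. *)
Record closedManifold (R : realType) (n : nat) := ClosedManifold {
  carrier :> ptopologicalType;
  chart_index : Type;
  chart_dom : chart_index -> set carrier;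
  chart_cod : chart_index -> set 'rV[R]_n;
  chart : chart_index -> carrier -> 'rV[R]_n;
  chart_inv : chart_index -> 'rV[R]_n -> carrier;
  carrier_hausdorff : hausdorff_space carrier;
  carrier_compact : compact [set: carrier];
  chart_dom_open : forall i, open (chart_dom i);
  chart_cod_open : forall i, open (chart_cod i);
  chart_dom_cover : forall p, exists i, chart_dom i p;
  chart_in_cod : forall i p, chart_dom i p -> chart_cod i (chart i p);
  chart_inv_in_dom : forall i x, chart_cod i x -> chart_dom i (chart_inv i x);
  chartK : forall i p, chart_dom i p -> chart_inv i (chart i p) = p;
  chart_invK : forall i x, chart_cod i x -> chart i (chart_inv i x) = x;
  chart_continuous : forall i, {within chart_dom i, continuous (chart i)};
  chart_inv_continuous :
    forall i, {within chart_cod i, continuous (chart_inv i)};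
  transition_smooth : forall i j (a : 'I_n),
    smooth_on (chart_cod i `&` chart_inv i @^-1` chart_dom j)
              (fun x => chart j (chart_inv i x) 0 a)
}.

Section Manifold.
Context {R : realType} {n : nat}.
Variable M : closedManifold R n.
Implicit Types (i j : chart_index M) (p : M) (u v : M -> R).

Definition in_chart i u : 'rV[R]_n -> R := fun x => u (chart_inv i x).

Definition Ck (m : nat) u : Prop :=
  forall i, Ck_on m (chart_cod i) (in_chart i u).

(* The Jacobian matrix of the transition map acts on row vectors from the
   right, hence the place of the transpose in metric_change. *)
Definition transition_jacobian i j (x : 'rV[R]_n) : 'M[R]_n :=
  \matrix_(a, b) partial a (fun y => chart j (chart_inv i y) 0 b) x.

Record riemannianMetric := RiemannianMetric {
  metric :> chart_index M -> 'rV[R]_n -> 'M[R]_n;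
  metric_smooth : forall i (a b : 'I_n),
    smooth_on (chart_cod i) (fun x => metric i x a b);
  metric_sym : forall i x, chart_cod i x -> (metric i x)^T = metric i x;
  metric_pos : forall i x (w : 'rV[R]_n), chart_cod i x -> w != 0 ->
    0 < (w *m metric i x *m w^T) 0 0;
  metric_change : forall i j x,
    chart_cod i x -> chart_dom j (chart_inv i x) ->
    metric i x = transition_jacobian i j x
                   *m metric j (chart j (chart_inv i x))
                   *m (transition_jacobian i j x)^T
}.

(* A finite family of closed coordinate balls (for the sup norm of R^n) whose
   interiors cover M. It fixes a choice of Hölder norms; another choice gives
   equivalent norms. *)
Record ballCover := BallCover {
  cov_size : nat;
  cov_chart : 'I_cov_size -> chart_index M;
  cov_center : 'I_cov_size -> 'rV[R]_n;
  cov_radius : 'I_cov_size -> R;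
  cov_radius_gt0 : forall k, 0 < cov_radius k;
  cov_sub : forall k,
    closed_ball (cov_center k) (cov_radius k) `<=` chart_cod (cov_chart k);
  cov_cover : forall p, exists k,
    chart_dom (cov_chart k) p /\
    ball (cov_center k) (cov_radius k) (chart (cov_chart k) p)
}.

Lemma ballCover_exists : exists _ : ballCover, True.
Proof.
have hp p : exists ir : chart_index M * R, [/\ chart_dom ir.1 p, 0 < ir.2 &
    closed_ball (chart ir.1 p) ir.2 `<=` chart_cod ir.1].
  have [i ip] := chart_dom_cover p.
  have hn : nbhs (chart i p) (chart_cod i).
    by apply: open_nbhs_nbhs; split;
      [exact: chart_cod_open | exact: chart_in_cod].
  have [r hr] := (nbhs_closedballP _ _).1 hn.
  exists (i, r%:num); split => /=; [exact: ip | by [] | exact: hr].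
pose F p := projT1 (cid (hp p)).
have hF p : [/\ chart_dom (F p).1 p, 0 < (F p).2 &
    closed_ball (chart (F p).1 p) (F p).2 `<=` chart_cod (F p).1].
  exact: projT2 (cid (hp p)).
pose V p := chart_dom (F p).1 `&`
  chart (F p).1 @^-1` ball (chart (F p).1 p) (F p).2.
have Vopen p : open (V p).
  rewrite openE => x [xd xb].
  have od := @chart_dom_open _ _ M (F p).1.
  apply: filterI; first exact: open_nbhs_nbhs.
  have := @chart_continuous _ _ M (F p).1.
  rewrite continuous_open_subspace// => /(_ x (mem_set xd)); apply.
  by apply: open_nbhs_nbhs; split => //; exact: ball_open.
have cM : cover_compact [set: M].
  by rewrite -compact_cover; exact: carrier_compact.
have /(_ M setT V (fun p _ => Vopen p)) [] := cM.
  move=> p _; exists p => //; have [h1 h2 _] := hF p.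
  by split => //=; exact: ballxx.
move=> D _ Dcov.
pose P (k : 'I_(size (enum_fset D))) : M := tnth (in_tuple (enum_fset D)) k.
have rad k : 0 < (F (P k)).2 by have [] := hF (P k).
have sub k : closed_ball (chart (F (P k)).1 (P k)) (F (P k)).2
    `<=` chart_cod (F (P k)).1 by have [] := hF (P k).
suff cov p : exists k, chart_dom (F (P k)).1 p /\
    ball (chart (F (P k)).1 (P k)) (F (P k)).2 (chart (F (P k)).1 p).
  by exists (BallCover rad sub cov).
have [y /= yD [pd pb]] := Dcov p I.
have /tnthP[k yk] : y \in in_tuple (enum_fset D) by [].
by exists k; rewrite /P -yk.
Qed.

Definition cover_of : ballCover := projT1 (cid ballCover_exists).

Definition cov_ball (k : 'I_(cov_size cover_of)) : set 'rV[R]_n :=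
  closed_ball (cov_center k) (cov_radius k).

(* The C^{m,th}(M) norm, with value +oo when it is infinite. *)
Definition holder_norm (m : nat) (th : R) u : \bar R :=
  (\sum_(k < cov_size cover_of)
     holder_norm_on m th (cov_ball k) (in_chart (cov_chart k) u))%E.

Definition holder_space (m : nat) (th : R) : set (M -> R) :=
  [set u | Ck m u /\ (holder_norm m th u < +oo)%E].

(* Continuity of a map R x C^{1,th} -> C^{0,th}; the map is total on functions
   M -> R, and only its values on C^{1,th} matter. *)
Definition continuous_holder_map (th : R) (h : R -> (M -> R) -> (M -> R)) :
    Prop :=
  forall (omega : R) u, holder_space 1 th u ->
  forall eps : R, 0 < eps -> exists2 delta : R, 0 < delta &
  forall (omega' : R) u', holder_space 1 th u' ->
    `|omega' - omega| < delta -> (holder_norm 1 th (u' \- u)%R < delta%:E)%E ->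
    (holder_norm 0 th (h omega' u' \- h omega u)%R < eps%:E)%E.

(* Tensorial quantities are computed at p in a chart around p; the result does
   not depend on the chart. *)
Definition cov_at p : 'I_(cov_size cover_of) :=
  projT1 (cid (cov_cover cover_of p)).

Definition chart_at p : chart_index M := cov_chart (cov_at p).

Variable g : riemannianMetric.

Definition scalar_curvature p : R :=
  scalar_curvature_loc (g (chart_at p)) (chart (chart_at p) p).

Definition laplace_beltrami u p : R :=
  let i := chart_at p in
  - divergence_loc (g i) (gradient_loc (g i) (in_chart i u)) (chart i p).

Definition two_star : R := 2 * n%:R / (n%:R - 2).

Definition is_positive_solution (q m1 omega : R) (hu u v : M -> R) : Prop :=
  [/\ forall p, 0 < u p,
      forall p, 0 < v p,
      forall p, laplace_beltrami u p + hu p * u p =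
        u p `^ (two_star - 1) + omega ^+ 2 * (1 - q * v p) ^+ 2 * u p &
      forall p, laplace_beltrami v p + (m1 ^+ 2 + q ^+ 2 * u p ^+ 2) * v p =
        q * u p ^+ 2].

End Manifold.

(* Main.v *)
(* Write p = 2* - 2 = 4/(n-2), A = max u and m = min u, and let
   r(s) = m1^2/(m1^2 + q^2 s^2), which is 1 - q v when u is the constant s. Fix
   W >= 1 above (n-2)/(4(n-1)) S_g, set T = W^(1/p), and take
     h_w(u) = max(0, W + w^2 r(m)^2 - lambda_w (A - u)),
   with lambda_w = 2W + 1 + w^2 Lip(r^2). At a maximum point of u the value is at
   least W, whence (i) and (ii).
   The only positive solution is the constant one with u = T. The maximum
   principle for the second equation gives r(A) <= 1 - q v <= r(m). At a maximum
   point of u the first equation then yields W <= A^p, that is T <= A, and at a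
   minimum point it yields
     m^p + w^2 r(A)^2 <= W + w^2 r(m)^2 - lambda_w (A - m),
   which forces A = m = T since T^p - m^p <= 2W (T - m) for m <= T. As T does not
   depend on w, the bound is uniform in w.
   Truncation is not continuous in Hölder norms, but h_w(u) is Lipschitz with a
   constant controlled by the C^1 norm of u, so uniform convergence can be
   interpolated to convergence in C^{0,theta}. *)
Require Import Defs.
From mathcomp Require Import all_boot all_order all_algebra.
From mathcomp Require Import all_classical all_reals all_analysis.
From mathcomp Require Import ring lra.
Set Implicit Arguments.
Unset Strict Implicit.
Unset Printing Implicit Defensive.
Import Order.TTheory GRing.Theory Num.Theory.
Import numFieldNormedType.Exports.
Local Open Scope classical_set_scope.
Local Open Scope ring_scope.

(** * Algebra of the classes C^m on open sets, and continuity of the scalar curvature *)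

Section DifferentiabilityClasses.
Context {R : realType} {n : nat}.
Implicit Types (U : set 'rV[R]_n) (f : 'rV[R]_n -> R).

Lemma Ck_on_continuous m U f x : open U -> Ck_on m U f -> U x ->
  {for x, continuous f}.
Proof.
move=> oU; case: m => [|m] [+ _] Ux;
  by rewrite continuous_open_subspace// => /(_ x); apply; rewrite inE.
Qed.

Lemma within_continuous_open U f : open U ->
  (forall x, U x -> {for x, continuous f}) -> {within U, continuous f}.
Proof.
by move=> oU cf; rewrite continuous_open_subspace// => x; rewrite inE => /cf.
Qed.

Lemma near_open U f f' x : open U -> {in U, f =1 f'} -> U x ->
  \near x, f x = f' x.
Proof.
move=> oU ff' Ux; near=> y; apply: ff'; rewrite inE; near: y.
exact: open_nbhs_nbhs.
Unshelve. all: by end_near. Qed.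

Lemma continuous_eq_on U f f' x : open U -> {in U, f =1 f'} -> U x ->
  {for x, continuous f} -> {for x, continuous f'}.
Proof.
move=> oU ff' Ux cf; rewrite /prop_for /continuous_at -ff' ?inE//.
have := near_open oU ff' Ux => nff'.
exact: cvg_trans (near_eq_cvg nff') cf.
Qed.

Lemma partial_eq_on U f f' a : open U -> {in U, f =1 f'} ->
  {in U, partial a f =1 partial a f'}.
Proof.
move=> oU ff' x; rewrite inE => Ux.
by apply: near_eq_derive; exact: near_open oU ff' Ux.
Qed.

(** On an open set, equality holds near each point and so passes to all iterated partial
    derivatives. This allows a formula valid only on [U], such as a quotient rule, to replace a
    function. *)
Lemma Ck_on_eq m U f f' : open U -> {in U, f =1 f'} ->
  Ck_on m U f -> Ck_on m U f'.
Proof.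
move=> oU; elim: m f f' => [|m IHm] f f' ff' Cf.
  split=> //; apply: within_continuous_open => // x Ux.
  exact: continuous_eq_on ff' Ux (Ck_on_continuous oU Cf Ux).
split.
  apply: within_continuous_open => // x Ux.
  exact: continuous_eq_on ff' Ux (Ck_on_continuous oU Cf Ux).
move=> a; have [df Cdf] := Cf.2 a; split.
  move=> x Ux; apply: near_eq_derivable (df x Ux).
  exact: near_open oU ff' Ux.
by apply: IHm Cdf; exact: partial_eq_on.
Qed.

Lemma Ck_onW m U f : Ck_on m.+1 U f -> Ck_on m U f.
Proof.
elim: m f => [|m IHm] f [cf df]; first by split.
by split=> // a; have [daf /IHm] := df a.
Qed.

Lemma smooth_on_partial U f a : smooth_on U f -> smooth_on U (partial a f).
Proof. by move=> sf m; have [_ /(_ a)[]] := sf m.+1. Qed.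

Lemma partial_cst a (c : R) : partial a (cst c : 'rV[R]_n -> R) = cst 0.
Proof. by apply/funext => x; rewrite /partial derive_cst. Qed.

Lemma Ck_on_cst m U (c : R) : Ck_on m U (fun=> c).
Proof.
have cc (c' : R) : {within U, continuous (fun=> c')}.
  by apply: continuous_subspaceT; exact: cst_continuous.
elim: m c => [|m IHm] c; split => // a.
by split=> [x _|]; [exact: derivable_cst|rewrite partial_cst; exact: IHm].
Qed.

Lemma Ck_onD m U f f' : open U -> Ck_on m U f -> Ck_on m U f' ->
  Ck_on m U (fun x => f x + f' x).
Proof.
move=> oU; elim: m f f' => [|m IHm] f f' Cf Cf'.
  split=> //; apply: within_continuous_open => // x Ux.
  exact: continuousD (Ck_on_continuous oU Cf Ux) (Ck_on_continuous oU Cf' Ux).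
split.
  apply: within_continuous_open => // x Ux.
  exact: continuousD (Ck_on_continuous oU Cf Ux) (Ck_on_continuous oU Cf' Ux).
move=> a; have [df Cdf] := Cf.2 a; have [df' Cdf'] := Cf'.2 a; split.
  by move=> x Ux; apply: derivableD; [exact: df|exact: df'].
apply: Ck_on_eq (IHm _ _ Cdf Cdf') => // x; rewrite inE => Ux.
by rewrite /partial -deriveD//; [exact: df|exact: df'].
Qed.

Lemma Ck_onM m U f f' : open U -> Ck_on m U f -> Ck_on m U f' ->
  Ck_on m U (fun x => f x * f' x).
Proof.
move=> oU; elim: m f f' => [|m IHm] f f' Cf Cf'.
  split=> //; apply: within_continuous_open => // x Ux.
  exact: continuousM (Ck_on_continuous oU Cf Ux) (Ck_on_continuous oU Cf' Ux).
split.
  apply: within_continuous_open => // x Ux.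
  exact: continuousM (Ck_on_continuous oU Cf Ux) (Ck_on_continuous oU Cf' Ux).
move=> a; have [df Cdf] := Cf.2 a; have [df' Cdf'] := Cf'.2 a; split.
  by move=> x Ux; apply: derivableM; [exact: df|exact: df'].
apply: Ck_on_eq (Ck_onD oU (IHm _ _ (Ck_onW Cf) Cdf') (IHm _ _ (Ck_onW Cf') Cdf)).
  by [].
move=> x; rewrite inE => Ux.
by rewrite /partial deriveM//; [exact: df|exact: df'].
Qed.

Lemma Ck_onV m U f : open U -> Ck_on m U f -> (forall x, U x -> f x != 0) ->
  Ck_on m U (fun x => (f x)^-1).
Proof.
move=> oU + f0; elim: m => [|m IHm] Cf.
  split=> //; apply: within_continuous_open => // x Ux.
  exact: continuousV (f0 _ Ux) (Ck_on_continuous oU Cf Ux).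
split.
  apply: within_continuous_open => // x Ux.
  exact: continuousV (f0 _ Ux) (Ck_on_continuous oU Cf Ux).
move=> a; have [df Cdf] := Cf.2 a; split.
  by move=> x Ux; apply: derivableV; [exact: f0|exact: df].
(* The derivative of 1/f is -f'/f^2; at order [m] the induction hypothesis covers the factors
   1/f. *)
have Vf := IHm (Ck_onW Cf).
have := Ck_onM oU (Ck_onM oU (Ck_on_cst _ _ (-1)) (Ck_onM oU Vf Vf)) Cdf.
apply: Ck_on_eq => // x; rewrite inE => Ux.
rewrite /partial deriveV//; [|exact: f0|exact: df].
by rewrite /GRing.scale /= mulN1r expr2 invfM.
Qed.

Lemma Ck_on_sum m U (I : Type) (r : seq I) (P : pred I) (F : I -> 'rV[R]_n -> R) :
  open U -> (forall i, P i -> Ck_on m U (F i)) ->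
  Ck_on m U (fun x => \sum_(i <- r | P i) F i x).
Proof.
move=> oU CF; elim: r => [|i r IHr].
  by apply: Ck_on_eq (Ck_on_cst _ _ 0) => // x _; rewrite big_nil.
have [Pi|nPi] := boolP (P i).
  by apply: Ck_on_eq (Ck_onD oU (CF i Pi) IHr) => // x _; rewrite big_cons Pi.
by apply: Ck_on_eq IHr => // x _; rewrite big_cons (negbTE nPi).
Qed.

Lemma Ck_on_prod m U (I : Type) (r : seq I) (P : pred I) (F : I -> 'rV[R]_n -> R) :
  open U -> (forall i, P i -> Ck_on m U (F i)) ->
  Ck_on m U (fun x => \prod_(i <- r | P i) F i x).
Proof.
move=> oU CF; elim: r => [|i r IHr].
  by apply: Ck_on_eq (Ck_on_cst _ _ 1) => // x _; rewrite big_nil.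
have [Pi|nPi] := boolP (P i).
  by apply: Ck_on_eq (Ck_onM oU (CF i Pi) IHr) => // x _; rewrite big_cons Pi.
by apply: Ck_on_eq IHr => // x _; rewrite big_cons (negbTE nPi).
Qed.

Lemma Ck_on_det m U k (G : 'rV[R]_n -> 'M[R]_k) : open U ->
  (forall a b, Ck_on m U (fun x => G x a b)) -> Ck_on m U (fun x => \det (G x)).
Proof.
move=> oU CG; rewrite /determinant; apply: Ck_on_sum => // s _.
apply: Ck_onM => //; first exact: Ck_on_cst.
exact: Ck_on_prod.
Qed.

(** Cramer's rule: the entries of the inverse are cofactors divided by the determinant. *)
Lemma Ck_on_invmx m U k (G : 'rV[R]_n -> 'M[R]_k) a b : open U ->
  (forall a b, Ck_on m U (fun x => G x a b)) ->
  (forall x, U x -> G x \in unitmx) ->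
  Ck_on m U (fun x => invmx (G x) a b).
Proof.
move=> oU CG uG.
have CV : Ck_on m U (fun x => (\det (G x))^-1).
  apply: Ck_onV => //; first exact: Ck_on_det.
  by move=> x /uG; rewrite unitmxE unitfE.
have Cc : Ck_on m U (fun x => cofactor (G x) b a).
  rewrite /cofactor; apply: Ck_onM => //; first exact: Ck_on_cst.
  apply: Ck_on_det => // c d.
  by apply: Ck_on_eq (CG (lift b c) (lift a d)) => // x _; rewrite !mxE.
apply: Ck_on_eq (Ck_onM oU CV Cc) => // x; rewrite inE => Ux.
by rewrite /invmx uG// !mxE.
Qed.

(** The curvature is a polynomial in the entries of the inverse metric, the Christoffel symbols and
    their first derivatives. It will be bounded on compact balls. *)
Lemma scalar_curvature_loc_continuous U (G : 'rV[R]_n -> 'M[R]_n) : open U ->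
  (forall a b, smooth_on U (fun x => G x a b)) ->
  (forall x, U x -> G x \in unitmx) ->
  forall x, U x -> {for x, continuous (scalar_curvature_loc G)}.
Proof.
move=> oU sG uG x Ux.
have sV a b : smooth_on U (fun x => invmx (G x) a b).
  by move=> m; apply: Ck_on_invmx => // c d; exact: sG.
have sC c a b : smooth_on U (christoffel G c a b).
  move=> m; rewrite /christoffel; apply: Ck_onM => //; first exact: Ck_on_cst.
  apply: Ck_on_sum => // d _; apply: Ck_onM => //; first exact: sV.
  have sP e i j : Ck_on m U (partial e (fun y => G y i j)).
    exact: (smooth_on_partial e (sG i j) m).
  apply: Ck_onD => //; first exact: Ck_onD.
  have := Ck_onM oU (Ck_on_cst m U (-1)) (sP d a b).
  by apply: Ck_on_eq => // y _; rewrite mulN1r.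
suff CS : Ck_on 0 U (scalar_curvature_loc G) by exact: Ck_on_continuous CS _.
have CN f : Ck_on 0 U f -> Ck_on 0 U (fun x => - f x).
  move=> /(Ck_onM oU (Ck_on_cst 0 U (-1))).
  by apply: Ck_on_eq => // y _; rewrite mulN1r.
apply: Ck_on_sum => // a _; apply: Ck_on_sum => // b _.
apply: Ck_onM => //; first exact: sV.
apply: Ck_on_sum => // c _; apply: Ck_onD => //; first apply: Ck_onD => //.
- exact: (smooth_on_partial c (sC c a b) 0%N).
- by apply: CN; exact: (smooth_on_partial b (sC c a c) 0%N).
apply: Ck_on_sum => // d _; apply: Ck_onD => //.
  by apply: Ck_onM => //; exact: sC.
by apply: CN; apply: Ck_onM => //; exact: sC.
Qed.

End DifferentiabilityClasses.

(** * Directional derivatives and the mean value theorem along lines *)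

Section DirectionalDerivatives.
Context {R : realType} {V : normedModType R}.
Implicit Types (f : V -> R) (x y v w : V).

(** The two difference quotients are the same function, so derivatives along a line and directional
    derivatives are exchanged without a chain rule. *)
Lemma growth_rate_line f y v t :
  (fun h => h^-1 *: (((fun s : R => f (s *: v + y)) \o shift t) (h *: 1)
                     - f (t *: v + y))) =
  (fun h => h^-1 *: ((f \o shift (t *: v + y)) (h *: v) - f (t *: v + y))).
Proof.
by apply/funext => h /=; rewrite [h *: 1]mulr1 scalerDl addrA.
Qed.

Lemma derivable_line f y v t : derivable f (t *: v + y) v ->
  derivable (fun s : R => f (s *: v + y)) t 1.
Proof. by rewrite /derivable -growth_rate_line. Qed.

Lemma derive_line f y v t :
  'D_1 (fun s : R => f (s *: v + y)) t = 'D_v f (t *: v + y).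
Proof. by rewrite /derive -growth_rate_line. Qed.

Lemma MVT_ray f y v (h : R) : 0 <= h ->
  (forall t, t \in `[0, h] -> derivable f (t *: v + y) v) ->
  exists2 c, c \in `[0, h] & f (h *: v + y) - f y = h * 'D_v f (c *: v + y).
Proof.
move=> h0 df; pose phi := fun s : R => f (s *: v + y).
have dphi (t : R) : t \in `[0, h] -> is_derive t 1 phi ('D_v f (t *: v + y)).
  move=> th; apply: DeriveDef; last exact: derive_line.
  by apply: derivable_line; exact: df.
have cphi : {within `[0, h], continuous phi}.
  by apply: derivable_within_continuous => t /dphi[].
have [c ch] := MVT_segment h0 (fun t th => dphi t (subset_itv_oo_cc th)) cphi.
by rewrite /phi scale0r add0r subr0 mulrC => E; exists c.
Qed.

Lemma MVT_line f y v (h : R) :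
  (forall t : R, `|t| <= `|h| -> derivable f (t *: v + y) v) ->
  exists2 c, `|c| <= `|h| &
    f (h *: v + y) - f y = h * 'D_v f (c *: v + y).
Proof.
move=> df; have [h0|h0] := leP 0 h.
  have abh (t : R) : t \in `[0, h] -> `|t| <= `|h|.
    by rewrite in_itv/= => /andP[t0 th]; rewrite !ger0_norm.
  have [c ch E] := MVT_ray h0 (fun t th => df t (abh t th)).
  by exists c; [exact: abh|].
have abh (t : R) : t \in `[0, - h] -> `|t + h| <= `|h|.
  by rewrite in_itv/= => /andP[t0 th]; rewrite (ltr0_norm h0) ler0_norm; lra.
(* For negative [h] the segment is traversed from its other end, over the length [- h]. *)
have [|t th|c ch] := @MVT_ray f (h *: v + y) v (- h).
- by rewrite oppr_ge0 ltW.
- by rewrite addrA -scalerDl; apply: df; exact: abh.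
rewrite !addrA -!scalerDl addNr scale0r add0r => E.
by exists (c + h); [exact: abh|rewrite -opprB E; ring].
Qed.

(* The increment along [w + c v] is the one along [w] followed by one along [v],
   and the mean value theorem controls the latter. *)
Lemma is_derive_step f x v w (c d : R) :
  is_derive x w f d -> (\forall y \near x, derivable f y v) ->
  {for x, continuous ('D_v f)} ->
  is_derive x (w + c *: v) f (d + c * 'D_v f x).
Proof.
move=> [dfw <-] dfv cD.
suff L : (fun h => h^-1 *: ((f \o shift x) (h *: (w + c *: v)) - f x)) @ 0^' -->
    'D_w f x + c * 'D_v f x.
  by apply: DeriveDef; [exact: cvgP L|exact: cvg_lim L].
pose g1 (h : R) := h^-1 *: ((f \o shift x) (h *: w) - f x).
pose g2 (h : R) := h^-1 * (f ((h * c) *: v + (h *: w + x)) - f (h *: w + x)).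
have -> : (fun h => h^-1 *: ((f \o shift x) (h *: (w + c *: v)) - f x)) =
    (fun h => g1 h + g2 h).
  apply/funext => h.
  change (h^-1 * (f (h *: (w + c *: v) + x) - f x) =
    h^-1 * (f (h *: w + x) - f x) + g2 h).
  rewrite /g2 -mulrDr.
  congr (_ * _); rewrite [RHS]addrC subrKA; congr (f _ - _).
  by rewrite scalerDr scalerA addrA [_ *: w + _]addrC.
apply: cvgD; first exact: dfw.
apply/cvgrPdist_le => e e0.
(* The error in the derivative along [v] gets multiplied by [c]; the added 1 covers [c = 0]. *)
have ec : 0 < e / (`|c| + 1) by rewrite divr_gt0// ltr_wpDl.
have : \forall y \near x, derivable f y v /\ `|'D_v f x - 'D_v f y| <= e / (`|c| + 1).
  near=> y; split; first by near: y.
  by near: y; move/cvgrPdist_le : cD; exact.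
move=> /nbhs_ballP[r /= r0 xr].
(* For [h] below r/K, every intermediate point of the mean value theorem stays within distance [r]
   of [x]. *)
pose K := `|c| * `|v| + `|w| + 1.
have K0 : 0 < K by rewrite ltr_wpDl// addr_ge0// mulr_ge0.
have inr (t h : R) : `|h| < r / K -> `|t| <= `|h * c| ->
    ball x r (t *: v + (h *: w + x)).
  move=> hr th; rewrite -ball_normE /= addrA opprD addrCA subrr addr0 normrN.
  rewrite (le_lt_trans (ler_normD _ _))// !normrZ.
  apply: (@le_lt_trans _ _ (`|h| * (`|c| * `|v| + `|w|))).
    by rewrite mulrDr lerD2r mulrA -normrM ler_wpM2r.
  rewrite ltr_pdivlMr// in hr; apply: le_lt_trans hr.
  by rewrite ler_wpM2l// /K lerDl.
near=> h.
have h0 : h != 0 by near: h; exact: nbhs_dnbhs_neq.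
have hr : `|h| < r / K.
  near: h; apply: dnbhs0_lt; exact: divr_gt0.
have [|t th] := @MVT_line f (h *: w + x) v (h * c).
  by move=> t th; have [] := xr _ (inr _ _ hr th).
rewrite /g2 => ->; rewrite -mulrA mulKf// -mulrBr normrM.
have [_ D] := xr _ (inr _ _ hr th).
apply: (le_trans (ler_wpM2l (normr_ge0 _) D)).
by rewrite mulrCA ler_piMr ?(ltW e0)// ler_pdivrMr ?ltr_wpDl// mul1r lerDl.
Unshelve. all: by end_near. Qed.

End DirectionalDerivatives.

(** * Derivatives of C^1 functions in arbitrary directions *)

Section ContinuouslyDifferentiable.
Context {R : realType} {n : nat}.
Implicit Types (U : set 'rV[R]_n) (f : 'rV[R]_n -> R).

(** [Ck_on] only speaks of coordinate directions; a general direction is built by adding its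
    coordinate components one at a time with [is_derive_step]. *)
Lemma Ck_on_is_derive m U f x w : open U -> Ck_on m.+1 U f -> U x ->
  is_derive x w f (\sum_(a < n) w 0 a * partial a f x).
Proof.
move=> oU [_ Cf] Ux; rewrite [w in is_derive _ w]row_sum_delta.
elim: (index_enum _) => [|a s IHs]; first by rewrite !big_nil; exact: is_derive0.
have [df Cdf] := Cf a.
rewrite !big_cons addrC [X in is_derive _ _ _ X]addrC.
apply: is_derive_step => //; last exact: Ck_on_continuous Cdf Ux.
by near=> y; apply: df; near: y; exact: open_nbhs_nbhs.
Unshelve. all: by end_near. Qed.

Lemma mx_entry_le (x : 'rV[R]_n) (a : 'I_n) : `|x 0 a| <= `|x|.
Proof.
rewrite [leRHS]/Num.norm /= mx_normrE.
by apply: (le_bigmax _ (fun ij : 'I_1 * 'I_n => `|x ij.1 ij.2|) (0, a)).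
Qed.

End ContinuouslyDifferentiable.

(** * First and second order conditions at an extremum *)

Section SecondDerivativeTest.
Context {R : realType}.

Lemma is_derive_min0 (phi : R -> R) (d : R) : (\forall t \near (0:R), derivable phi t 1) ->
  (forall t, phi 0 <= phi t) -> is_derive (0:R) 1 phi d -> d = 0.
Proof.
move=> /nbhs_ballP[r /= r0 dr] min0 d0.
have r1 (t : R) : t \in `](- r), r[ -> derivable phi t 1.
  rewrite in_itv/= -ltr_norml => tr; apply: dr.
  by rewrite -ball_normE /= sub0r normrN.
have := @derive1_at_min R phi (- r) r 0 _ r1 _ (fun t _ => min0 t).
rewrite in_itv/= oppr_lt0 r0 => /(_ _ isT) d0'.
have := @derive_val _ _ _ _ _ _ _ d0; have := @derive_val _ _ _ _ _ _ _ (d0' _).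
by rewrite ge0_cp ?(ltW r0)// => /(_ isT) -> ->.
Qed.

(** Since [dphi 0 = 0], a negative [l] would make [dphi] negative just to the right of 0, and the
    mean value theorem would give a value of [phi] below [phi 0]. *)
Lemma second_derivative_min (phi dphi : R -> R) (l : R) :
  (\forall t \near (0:R), is_derive t (1:R) phi (dphi t)) ->
  is_derive (0:R) 1 dphi l -> (forall t, phi 0 <= phi t) -> 0 <= l.
Proof.
move=> nphi [ddphi dl] min0; rewrite leNgt; apply/negP => l0.
have dphi0 : dphi 0 = 0.
  apply: is_derive_min0 min0 (nbhs_singleton nphi).
  by apply: filterS nphi => t [].
have : \forall h \near (0 : R)^', h^-1 * dphi h < 0.
  have cl : (fun h => h^-1 *: ((dphi \o shift 0) (h *: 1) - dphi 0)) @ 0^' --> l.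
    by rewrite -dl; exact: ddphi.
  near=> h.
  have : h^-1 *: ((dphi \o shift 0) (h *: 1) - dphi 0) < 0.
    by near: h; exact: (@cvgr_lt _ _ _ (dnbhs_filter (0 : R)) _ l cl 0 l0).
  by rewrite /= dphi0 subr0 addr0 [h *: 1]mulr1.
move=> /nbhs_ballP[r /= r0 hr].
move/nbhs_ballP : nphi => [r' /= r'0 hr'].
pose m := Num.min r r' / 2.
have m0 : 0 < m by rewrite divr_gt0// lt_min r0.
have mr : m < r.
  by rewrite ltr_pdivrMr// (le_lt_trans (_ : _ <= r))// ?ge_min ?lexx// ltr_pMr// ltr1n.
have mr' : m < r'.
  by rewrite ltr_pdivrMr// (le_lt_trans (_ : _ <= r'))// ?ge_min ?lexx ?orbT// ltr_pMr// ltr1n.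
have dm (t : R) : t \in `[0, m] -> is_derive t (1:R) phi (dphi t).
  rewrite in_itv/= => /andP[t0 tm]; apply: hr'.
  by rewrite -ball_normE /= sub0r normrN ger0_norm// (le_lt_trans tm).
have cphi : {within `[0, m], continuous phi}.
  by apply: derivable_within_continuous => t /dm[].
have [c] := MVT m0 (fun t ht => dm t (subset_itv_oo_cc ht)) cphi.
rewrite in_itv/= => /andP[c0 cm]; rewrite subr0 => E.
have : c^-1 * dphi c < 0.
  apply: hr; last by rewrite gt_eqF.
  by rewrite -ball_normE /= sub0r normrN gtr0_norm// (lt_trans cm).
rewrite pmulr_rlt0 ?invr_gt0// => dc0.
by have := min0 m; rewrite -subr_ge0 E pmulr_lge0// leNgt dc0.
Unshelve. all: by end_near. Qed.

Context {n : nat}.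
Variables (U : set 'rV[R]_n) (f : 'rV[R]_n -> R) (x : 'rV[R]_n).
Hypotheses (oU : open U) (Cf : Ck_on 2 U f) (Ux : U x).

Lemma near_line (w : 'rV[R]_n) : \forall t \near (0:R), U (t *: w + x).
Proof.
have c0 : (fun t : R => t *: w + x) @ (0:R) --> x.
  rewrite -[X in _ --> X]add0r -[in X in _ --> X](scale0r w).
  by apply: cvgD; [apply: cvgZr_tmp; exact: cvg_id|exact: cvg_cst].
by apply: c0; exact: open_nbhs_nbhs.
Qed.

Lemma is_derive_on_line (w : 'rV[R]_n) : \forall t \near (0:R),
  is_derive t (1:R) (fun s => f (s *: w + x))
    (\sum_(a < n) w 0 a * partial a f (t *: w + x)).
Proof.
apply: filterS (near_line w) => t Ut.
have [df <-] := Ck_on_is_derive w oU Cf Ut.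
by apply: DeriveDef; [exact: derivable_line|exact: derive_line].
Qed.

Lemma is_derive2_on_line (w : 'rV[R]_n) :
  is_derive (0:R) 1 (fun t => \sum_(a < n) w 0 a * partial a f (t *: w + x))
    (\sum_(a < n) \sum_(b < n) w 0 a * w 0 b * partial b (partial a f) x).
Proof.
have -> : (fun t => \sum_(a < n) w 0 a * partial a f (t *: w + x)) =
  \sum_(a < n) (w 0 a *: (fun t => partial a f (t *: w + x))).
  by apply/funext => t; rewrite fct_sumE.
apply: is_derive_sum => a.
under eq_bigr do rewrite -mulrA.
rewrite -mulr_sumr; apply: is_deriveZ.
have Ca : Ck_on 1 U (partial a f) := (Cf.2 a).2.
have [df <-] := Ck_on_is_derive w oU Ca Ux.
have x0 : 0 *: w + x = x by rewrite scale0r add0r.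
apply: DeriveDef.
  by apply: derivable_line; rewrite x0.
by rewrite derive_line x0.
Qed.

(* [s = 1] for a minimum, [s = -1] for a maximum. *)
Variable s : R.
Hypothesis fmin : forall y, s * f x <= s * f y.

Lemma extremum_hessian (w : 'rV[R]_n) :
  0 <= s * \sum_(a < n) \sum_(b < n) w 0 a * w 0 b * partial b (partial a f) x.
Proof.
apply: (@second_derivative_min (s \*: (fun t => f (t *: w + x)))
  (s \*: (fun t => \sum_(a < n) w 0 a * partial a f (t *: w + x)))).
- by apply: filterS (is_derive_on_line w) => t dt; exact: is_deriveZ.
- by apply: is_deriveZ; exact: is_derive2_on_line.
- by move=> t /=; rewrite scale0r add0r; exact: fmin.
Qed.

Lemma extremum_critical a : s != 0 -> partial a f x = 0.
Proof.
move=> s0; apply: (mulfI s0); rewrite mulr0.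
apply: (@is_derive_min0 (s \*: (fun t => f (t *: delta_mx 0 a + x)))).
- apply: filterS (is_derive_on_line (delta_mx 0 a)) => t [dt _].
  exact: derivableZ.
- by move=> t /=; rewrite scale0r add0r; exact: fmin.
- have [df _] := Cf.2 a.
  have x0 : 0 *: delta_mx 0 a + x = x by rewrite scale0r add0r.
  apply: is_deriveZ; apply: DeriveDef.
    by apply: derivable_line; rewrite x0; exact: df.
  by rewrite derive_line x0.
Qed.

End SecondDerivativeTest.

(** * Gram factorization of positive definite matrices *)

Section PositiveDefiniteMatrices.
Context {R : realType}.

(* Induction on the size, through the Schur complement of the upper left entry. *)
Lemma posdef_gram k (P : 'M[R]_k) : P^T = P ->
  (forall w : 'rV_k, w != 0 -> 0 < (w *m P *m w^T) 0 0) ->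
  exists B : 'M[R]_k, P = B^T *m B.
Proof.
elim: k P => [|k IHk] P; first by exists 0; rewrite [LHS]flatmx0 [RHS]flatmx0.
rewrite -[k.+1]/(1 + k)%N in P *; rewrite -(submxK P).
set a := ulsubmx _; set b := ursubmx _; set c := dlsubmx _; set d := drsubmx _.
rewrite tr_block_mx => /eq_block_mx[_ cb _ ds] pos.
have {}cb : c = b^T by rewrite -cb trmxK.
pose al := a 0 0.
have aE : a = al%:M by rewrite [LHS]mx11_scalar.
have al0 : 0 < al.
  have := pos (row_mx 1%:M 0).
  rewrite mul_row_block tr_row_mx mul_row_col !mul1mx !mul0mx !addr0 trmx0 mulmx0 addr0.
  rewrite trmx1 mulmx1; apply; apply/eqP => /(congr1 (fun M : 'rV[R]_(1 + k) => lsubmx M 0 0)).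
  by rewrite row_mxKl !mxE => /eqP; rewrite oner_eq0.
pose S := d - al^-1 *: (b^T *m b).
have [||B' SE] := IHk S.
- by rewrite /S linearB linearZ /= trmx_mul trmxK ds.
- move=> v v0.
  (* The first component minimizes the form for given [v]: the cross terms cancel and the form of
     the Schur complement [S] at [v] remains. *)
  have := pos (row_mx (- al^-1 *: (v *m b^T)) v).
  rewrite mul_row_block tr_row_mx mul_row_col cb aE.
  rewrite mul_mx_scalar scalerA mulrN divff ?gt_eqF// scaleN1r addNr mul0mx add0r.
  rewrite -scalemxAl /S mulmxBr -scalemxAr mulmxA addrC !scaleNr; apply.
  apply/eqP => /(congr1 (fun M : 'rV[R]_(1 + k) => rsubmx M)).
  by rewrite row_mxKr linear0 => /eqP; rewrite (negbTE v0).
have sq : Num.sqrt al * Num.sqrt al = al by rewrite -expr2 sqr_sqrtr// ltW.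
have s0 : Num.sqrt al != 0 by rewrite gt_eqF// sqrtr_gt0.
exists (block_mx (Num.sqrt al)%:M ((Num.sqrt al)^-1 *: b) 0 B').
rewrite tr_block_mx mulmx_block trmx0 !mul0mx !mulmx0 !addr0.
rewrite !tr_scalar_mx -!scalar_mxM sq -aE cb.
have -> : ((Num.sqrt al)^-1 *: b)^T = (Num.sqrt al)^-1 *: b^T by rewrite linearZ.
rewrite mul_scalar_mx mul_mx_scalar !scalerA !(mulVf, mulfV)// !scale1r.
by rewrite -scalemxAl -scalemxAr scalerA -invfM sq -SE /S addrC subrK.
Qed.

Lemma posdef_unitmx k (P : 'M[R]_k) :
  (forall w : 'rV_k, w != 0 -> 0 < (w *m P *m w^T) 0 0) -> P \in unitmx.
Proof.
move=> pos; rewrite -row_free_unit -kermx_eq0; apply/negPn/negP.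
move=> /rowV0Pn[w /sub_kermxP wP w0].
by have := pos w w0; rewrite wP mul0mx mxE ltxx.
Qed.

Lemma invmx_gram k (P : 'M[R]_k) : P^T = P ->
  (forall w : 'rV_k, w != 0 -> 0 < (w *m P *m w^T) 0 0) ->
  exists B : 'M[R]_k, invmx P = B^T *m B.
Proof.
move=> symP pos; have uP := posdef_unitmx pos.
apply: posdef_gram; first by rewrite trmx_inv symP.
(* The form of [P] at w P^-1 is the form of P^-1 at [w]. *)
move=> w w0; have := pos (w *m invmx P).
rewrite trmx_mul trmx_inv symP mulmxKV// mulmxA; apply.
by apply: contra_neq w0 => /(congr1 (mulmx^~ P)); rewrite mulmxKV// mul0mx.
Qed.

(** The contraction is the sum, over the rows of [B], of the quadratic form of [H] at each row. *)
Lemma gram_contraction_ge0 k (B H : 'M[R]_k) :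
  (forall w : 'rV_k, 0 <= \sum_a \sum_b w 0 a * w 0 b * H a b) ->
  0 <= \sum_a \sum_b (B^T *m B) a b * H a b.
Proof.
move=> H0.
have -> : \sum_a \sum_b (B^T *m B) a b * H a b =
    \sum_c \sum_a \sum_b row c B 0 a * row c B 0 b * H a b.
  rewrite [RHS]exchange_big; apply: eq_bigr => a _ /=.
  rewrite [RHS]exchange_big; apply: eq_bigr => b _ /=.
  by rewrite mxE mulr_suml; apply: eq_bigr => c _; rewrite !mxE.
by apply: sumr_ge0 => c _.
Qed.

End PositiveDefiniteMatrices.

(** * Sign of the Laplacian at an extremum, in coordinates *)

Section LocalLaplacian.
Context {R : realType}.

(* Only continuity of [W] is needed, since [F] vanishes at [x]. *)
Lemma is_deriveM0 (V : normedModType R) (W F : V -> R) x v :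
  {for x, continuous W} -> derivable F x v -> F x = 0 ->
  is_derive x v (fun y => W y * F y) (W x * 'D_v F x).
Proof.
move=> cW dF F0.
have c0 : (fun h : R => h *: v + x) @ (0:R)^' --> x.
  rewrite -[X in _ --> X]add0r -[in X in _ --> X](scale0r v).
  apply: cvgD; last exact: cvg_cst.
  by apply: cvgZr_tmp; exact: nbhs_dnbhs.
suff L : (fun h => h^-1 *: (((fun y => W y * F y) \o shift x) (h *: v) - W x * F x))
    @ 0^' --> W x * 'D_v F x.
  by apply: DeriveDef; [exact: cvgP L|exact: cvg_lim L].
have -> : (fun h => h^-1 *: (((fun y => W y * F y) \o shift x) (h *: v) - W x * F x)) =
    (fun h => W (h *: v + x) * (h^-1 *: ((F \o shift x) (h *: v) - F x))).
  apply/funext => h /=; rewrite F0 mulr0 !subr0.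
  exact: mulrCA.
by apply: cvgM; [exact: cvg_comp c0 cW|exact: dF].
Qed.

Context {n : nat}.
Variables (U : set 'rV[R]_n) (G : 'rV[R]_n -> 'M[R]_n) (f : 'rV[R]_n -> R).
Variable x : 'rV[R]_n.
Hypotheses (oU : open U) (Cf : Ck_on 2 U f) (Ux : U x).
Hypothesis CG : forall a b, Ck_on 0 U (fun y => G y a b).
Hypothesis symG : (G x)^T = G x.
Hypothesis posG : forall y (w : 'rV[R]_n), U y -> w != 0 ->
  0 < (w *m G y *m w^T) 0 0.

(** Where the gradient vanishes, the product rule keeps only the terms that differentiate it, so no
    derivative of the metric survives. The two density factors stay uncancelled, as their product
    enters later through its sign alone. *)
Lemma divergence_gradient_critical : (forall a, partial a f x = 0) ->
  divergence_loc G (gradient_loc G f) x =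
  (volume_density G x)^-1 * volume_density G x *
  \sum_(a < n) \sum_(b < n) invmx (G x) a b * partial a (partial b f) x.
Proof.
move=> f0; rewrite /divergence_loc -mulrA; congr (_ * _).
rewrite mulr_sumr; apply: eq_bigr => a _; rewrite /gradient_loc.
pose W b := fun y => volume_density G y * invmx (G y) a b.
have cW b : {for x, continuous (W b)}.
  have uG y : U y -> G y \in unitmx.
    by move=> Uy; apply: posdef_unitmx => w; exact: posG.
  apply: continuousM.
    apply: continuous_comp; last exact: sqrt_continuous.
    exact: Ck_on_continuous oU (Ck_on_det oU CG) Ux.
  exact: Ck_on_continuous oU (Ck_on_invmx a b oU CG uG) Ux.
have dWF b : is_derive x (delta_mx 0 a) (fun y => W b y * partial b f y)
    (W b x * partial a (partial b f) x).
  apply: is_deriveM0 => //.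
  have Cb : Ck_on 1 U (partial b f) := (Cf.2 b).2.
  by have [db _] := Cb.2 a; exact: db.
have -> : (fun y => volume_density G y *
    \sum_(b < n) invmx (G y) a b * partial b f y) =
    \sum_(b < n) (fun y => W b y * partial b f y).
  apply/funext => y; rewrite fct_sumE mulr_sumr.
  by apply: eq_bigr => b _; rewrite mulrA.
rewrite /partial (@derive_val _ _ _ _ _ _ _ (is_derive_sum dWF)).
by rewrite mulr_sumr; apply: eq_bigr => b _; rewrite mulrA.
Qed.

(** The inverse metric is a Gram matrix and is contracted with [s] times the Hessian, which is
    semidefinite at the extremum. *)
Lemma divergence_gradient_extremum s : s != 0 ->
  (forall y, s * f x <= s * f y) ->
  0 <= s * divergence_loc G (gradient_loc G f) x.
Proof.
move=> s0 fmin; rewrite divergence_gradient_critical; last first.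
  by move=> a; exact: (extremum_critical oU Cf Ux fmin a s0).
rewrite mulrCA; apply: mulr_ge0.
  by rewrite mulr_ge0// ?invr_ge0 sqrtr_ge0.
have [B ->] := invmx_gram symG (fun w w0 => posG Ux w0).
have := @gram_contraction_ge0 _ _ B (\matrix_(a, b) (s * partial a (partial b f) x)).
have -> : \sum_a \sum_b (B^T *m B) a b *
    (\matrix_(a, b) (s * partial a (partial b f) x)) a b =
  s * \sum_a \sum_b (B^T *m B) a b * partial a (partial b f) x.
  rewrite mulr_sumr; apply: eq_bigr => a _; rewrite mulr_sumr.
  by apply: eq_bigr => b _; rewrite mxE mulrCA.
apply=> w; apply: le_trans (extremum_hessian oU Cf Ux fmin w) _.
(* The two sides differentiate in opposite orders; exchanging the sums matches them without invoking
   symmetry of second derivatives. *)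
rewrite exchange_big mulr_sumr; apply: ler_sum => a _; rewrite mulr_sumr.
by apply: ler_sum => b _; rewrite mxE mulrCA [w 0 b * _]mulrC.
Qed.

End LocalLaplacian.

(** * Maximum principle and curvature bound on the manifold *)

Section ManifoldLaplacian.
Context {R : realType} {n : nat} {M : closedManifold R n}.
Implicit Types (u : M -> R) (p : M).

Lemma chart_atP p : chart_dom (chart_at p) p /\
  cov_ball (cov_at p) (chart (chart_at p) p).
Proof.
rewrite /chart_at /cov_at; case: cid => k [pk bk]; split => //=.
exact: subset_closed_ball bk.
Qed.

Lemma chart_at_cod p : chart_cod (chart_at p) (chart (chart_at p) p).
Proof. by apply: chart_in_cod; have [] := chart_atP p. Qed.

Lemma in_chart_at u p :
  in_chart (chart_at p) u (chart (chart_at p) p) = u p.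
Proof. by rewrite /in_chart chartK//; have [] := chart_atP p. Qed.

Lemma Ck_continuous m u : Ck m u -> continuous u.
Proof.
move=> Cu p; have [pd _] := chart_atP p; set i := chart_at p in pd.
have near_dom : \near p, in_chart i u (chart i p) = u p.
  near=> p'; rewrite /in_chart chartK//; near: p'.
  by apply: open_nbhs_nbhs; split => //; exact: chart_dom_open.
have cc : {for p, continuous (chart i)}.
  have := @chart_continuous _ _ M i.
  rewrite continuous_open_subspace; last exact: chart_dom_open.
  by apply; rewrite inE.
have cu := Ck_on_continuous (@chart_cod_open _ _ M i) (Cu i) (chart_in_cod pd).
rewrite /continuous_at -(nbhs_singleton near_dom).
exact: cvg_trans (near_eq_cvg near_dom) (continuous_comp cc cu).
Unshelve. all: by end_near. Qed.

Lemma extrema_exist u : continuous u ->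
  (exists p, forall p', u p <= u p') /\ (exists p, forall p', u p' <= u p).
Proof.
move=> cu.
have M0 : [set: M] !=set0 by exists point.
have cT : {within [set: M], continuous u} by exact: continuous_subspaceT.
have [p _ hp] := compact_EVT_min M0 (@carrier_compact _ _ M) cT.
have [p' _ hp'] := compact_EVT_max M0 (@carrier_compact _ _ M) cT.
by split; [exists p => t|exists p' => t]; [apply: hp|apply: hp']; rewrite inE.
Qed.

Variable g : riemannianMetric M.

(** Pointwise maximum principle: as the Laplacian is minus a divergence, it is nonpositive at a
    minimum ([s = 1]) and nonnegative at a maximum ([s = -1]). *)
Lemma laplace_beltrami_extremum u p (s : R) : Ck 2 u -> s != 0 ->
  (forall p', s * u p <= s * u p') -> s * laplace_beltrami g u p <= 0.
Proof.
move=> Cu s0 umin; rewrite /laplace_beltrami mulrN oppr_le0.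
set i := chart_at p.
apply: (@divergence_gradient_extremum _ _ (chart_cod i)) => //.
- exact: chart_cod_open.
- exact: chart_at_cod.
- by move=> a b; exact: (metric_smooth g i a b 0%N).
- by apply: Defs.metric_sym; exact: chart_at_cod.
- by move=> y w; exact: metric_pos.
(* The extremum is global on [M], so the comparison holds even at [y] off the codomain, where
   [chart_inv] is arbitrary. *)
- by move=> y; rewrite in_chart_at; exact: umin.
Qed.

Lemma laplace_beltrami_cst (c : R) p : laplace_beltrami g (cst c) p = 0.
Proof.
rewrite /laplace_beltrami /divergence_loc big1 ?mulr0 ?oppr0// => a _.
rewrite -[RHS](derive_cst (0 : R) (chart (chart_at p) p) (delta_mx 0 a)).
congr ('D_ _ _ _); apply/funext => y; rewrite /gradient_loc big1 ?mulr0// => b _.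
by rewrite -[in_chart _ _]/(cst c) partial_cst mulr0.
Qed.

(** The curvature at a point is computed in the chart of a covering ball containing it, so the
    largest of the finitely many maxima over these compact balls is a bound. Independence of the
    chart is not invoked. *)
Lemma scalar_curvature_bounded : exists C, forall p, scalar_curvature g p <= C.
Proof.
have hk (k : 'I_(cov_size (cover_of M))) : exists C, forall x, cov_ball k x ->
    scalar_curvature_loc (g (cov_chart k)) x <= C.
  set i := cov_chart k.
  have cS x : chart_cod i x -> {for x, continuous (scalar_curvature_loc (g i))}.
    apply: scalar_curvature_loc_continuous; first exact: chart_cod_open.
      exact: metric_smooth.
    by move=> y iy; apply: posdef_unitmx => w; exact: metric_pos.
  have [|||c _ hc] := @EVT_max_rV R n (scalar_curvature_loc (g i)) (cov_ball k).
  - exists (cov_center k); apply: closed_ballxx; exact: cov_radius_gt0.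
  - apply: bounded_closed_compact; last exact: closed_ball_closed.
    have r0 := cov_radius_gt0 k; exists (`|cov_center k| + cov_radius k).
    split => [|N hN x]; first exact: num_real.
    rewrite /cov_ball closed_ballE// => kx; apply: le_trans (ltW hN).
    rewrite -lerBlDl; apply: le_trans kx.
    by rewrite -[X in _ <= X]normrN opprB; exact: lerB_dist.
  - apply: continuous_in_subspaceT => x; rewrite inE => /cov_sub; exact: cS.
  by exists (scalar_curvature_loc (g i) c) => x kx; apply: hc; rewrite inE.
pose C k := projT1 (cid (hk k)).
exists (\big[Num.max/0]_k C k) => p; rewrite /scalar_curvature.
apply: le_trans (le_bigmax _ C (cov_at p)).
by rewrite /C; case: cid => c /=; apply; have [] := chart_atP p.
Qed.

End ManifoldLaplacian.

(** * Hölder norms on sets of R^n *)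

Section HolderNorms.
Context {R : realType} {n : nat}.
Implicit Types (B : set 'rV[R]_n) (f : 'rV[R]_n -> R) (th : R).

Lemma sup_norm_on_ub B f x : B x -> (`|f x|%:E <= sup_norm_on B f)%E.
Proof. by move=> Bx; apply: ereal_sup_ubound; exists x. Qed.

Lemma sup_norm_on_ge0 B f : B !=set0 -> (0 <= sup_norm_on B f)%E.
Proof.
by move=> [x Bx]; apply: le_trans (sup_norm_on_ub f Bx); rewrite lee_fin.
Qed.

(** Two distinct points are required because the supremum of the empty set is [-oo]. *)
Lemma holder_seminorm_on_ge0 th B f :
  (exists x y, [/\ B x, B y & x != y]) -> (0 <= holder_seminorm_on th B f)%E.
Proof.
move=> [x [y [Bx By xy]]].
apply: (@le_trans _ _ (`|f x - f y| / `|x - y| `^ th)%:E).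
  by rewrite lee_fin divr_ge0// powR_ge0.
by apply: ereal_sup_ubound; exists x, y.
Qed.

Lemma holder_norm_on_ge0 m th B f :
  (exists x y, [/\ B x, B y & x != y]) -> (0 <= holder_norm_on m th B f)%E.
Proof.
move=> B2; have B0 : B !=set0 by have [x [y [Bx _ _]]] := B2; exists x.
elim: m f => [|m IHm] f /=; apply: adde_ge0.
- exact: sup_norm_on_ge0.
- exact: holder_seminorm_on_ge0.
- exact: sup_norm_on_ge0.
- by apply: sume_ge0 => a _; exact: IHm.
Qed.

Lemma holder_norm_on1_ub th B f x : (exists x y, [/\ B x, B y & x != y]) -> B x ->
  ((`|f x| + \sum_(a < n) `|partial a f x|)%:E <= holder_norm_on 1 th B f)%E.
Proof.
move=> B2 Bx /=; rewrite EFinD -sumEFin; apply: leeD; first exact: sup_norm_on_ub.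
apply: lee_sum => a _; apply: le_trans (sup_norm_on_ub _ Bx) _.
by apply: leeDl; exact: holder_seminorm_on_ge0.
Qed.

(* The Lipschitz bound is used at distances below [rho] and the sup bound beyond. *)
Lemma holder_norm_on0_interpolation th B f (s K rho : R) :
  0 < th -> th < 1 -> 0 <= K -> 0 < rho ->
  (forall x, B x -> `|f x| <= s) ->
  (forall x y, B x -> B y -> `|f x - f y| <= K * `|x - y|) ->
  (holder_norm_on 0 th B f <=
   (s + (K * rho `^ (1 - th) + 2 * s * (rho `^ th)^-1))%:E)%E.
Proof.
move=> th0 th1 K0 rho0 fs fK /=; rewrite EFinD; apply: leeD.
  by apply: ge_ereal_sup => _ [x Bx <-]; rewrite lee_fin fs.
apply: ge_ereal_sup => _ [x [y [Bx By xy ->]]]; rewrite lee_fin.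
have s0 : 0 <= s by apply: le_trans (fs x Bx).
have d0 : 0 < `|x - y| by rewrite normr_gt0 subr_eq0.
rewrite ler_pdivrMr ?powR_gt0// mulrDl.
have [dr|rd] := leP `|x - y| rho.
  apply: ler_wpDr; first by rewrite !mulr_ge0// ?invr_ge0 powR_ge0.
  apply: le_trans (fK _ _ Bx By) _; rewrite -mulrA ler_wpM2l//.
  have E : `|x - y| = `|x - y| `^ (1 - th) * `|x - y| `^ th.
    rewrite -powRD; last by apply/implyP => _; rewrite gt_eqF.
    by rewrite subrK powRr1// ltW.
  rewrite [leLHS]E ler_wpM2r ?powR_ge0// ge0_ler_powR ?nnegrE ?(ltW d0) ?(ltW rho0)//.
  by rewrite subr_ge0 ltW.
apply: ler_wpDl; first by rewrite !mulr_ge0// powR_ge0.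
apply: (@le_trans _ _ (2 * s)).
  rewrite mulr2n mulrDl mul1r; apply: le_trans (ler_normB _ _) _.
  by rewrite lerD// fs.
rewrite -[leRHS]mulrA ler_peMr ?mulr_ge0// ler_pdivlMl ?powR_gt0// mulr1.
by rewrite ge0_ler_powR ?nnegrE ?(ltW d0) ?(ltW rho0)// ltW.
Qed.

Lemma holder_norm_on1_cst th B (c : R) :
  (exists x y, [/\ B x, B y & x != y]) -> 
  (holder_norm_on 1 th B (cst c) <= `|c|%:E)%E.
Proof.
move=> [x [y [Bx By xy]]] /=; rewrite -[leRHS]adde0; apply: leeD.
  by apply: ge_ereal_sup => _ [z Bz <-].
apply: sume_le0 => a _; rewrite partial_cst -[leRHS]adde0; apply: leeD.
  by apply: ge_ereal_sup => _ [z Bz <-]; rewrite normr0.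
by apply: ge_ereal_sup => _ [z [t [_ _ _ ->]]]; rewrite subrr normr0 mul0r.
Qed.

Lemma closed_ball_segment (c x y : 'rV[R]_n) (r t : R) : 0 < r ->
  closed_ball c r x -> closed_ball c r y -> t \in `[0, 1] ->
  closed_ball c r (t *: (x - y) + y).
Proof.
move=> r0; rewrite !closed_ballE// /closed_ball_ /= in_itv /= => cx cy /andP[t0 t1].
have -> : c - (t *: (x - y) + y) = t *: (c - x) + (1 - t) *: (c - y).
  by apply/rowP => i; rewrite !mxE; ring.
apply: le_trans (ler_normD _ _) _; rewrite !normrZ (ger0_norm t0) ger0_norm ?subr_ge0//.
have -> : r = t * r + (1 - t) * r by ring.
by rewrite lerD// ler_wpM2l// subr_ge0.
Qed.

(** Mean value theorem on the segment, which stays in the ball by convexity. Distances are in the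
    sup norm, whose dual is the sum norm; hence the sum of partial derivatives. *)
Lemma closed_ball_lipschitz U f (c x y : 'rV[R]_n) (r D : R) : open U ->
  Ck_on 1 U f -> 0 < r -> closed_ball c r `<=` U ->
  (forall z, closed_ball c r z -> \sum_(a < n) `|partial a f z| <= D) ->
  closed_ball c r x -> closed_ball c r y -> `|f x - f y| <= D * `|x - y|.
Proof.
move=> oU Cf r0 BU hD Bx By.
have df t : t \in `[0, 1] -> derivable f (t *: (x - y) + y) (x - y).
  move=> t01; have := closed_ball_segment r0 Bx By t01.
  by move=> /BU/(Ck_on_is_derive (x - y) oU Cf)[].
have [t t01] := MVT_ray ler01 df.
rewrite scale1r subrK mul1r => ->.
have Bt := closed_ball_segment r0 Bx By t01.
have [_ ->] := Ck_on_is_derive (x - y) oU Cf (BU _ Bt).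
apply: le_trans (ler_norm_sum _ _ _) _.
apply: (@le_trans _ _ (\sum_(a < n) `|partial a f (t *: (x - y) + y)| * `|x - y|)).
  by apply: ler_sum => a _; rewrite normrM mulrC ler_wpM2l// mx_entry_le.
by rewrite -mulr_suml ler_wpM2r// hD.
Qed.

Lemma closed_ball_two_points (c : 'rV[R]_n) (r : R) : (0 < n)%N -> 0 < r ->
  exists x y, [/\ closed_ball c r x, closed_ball c r y & x != y].
Proof.
move=> n0 r0; pose w : 'rV[R]_n := const_mx 1.
have w0 : w != 0.
  by apply/eqP => /rowP/(_ (Ordinal n0))/eqP; rewrite !mxE oner_eq0.
(* The center and a point at distance exactly [r] from it. *)
exists c, (c - (r / `|w|) *: w); split.
- exact: closed_ballxx.
- rewrite closed_ballE// /closed_ball_ /= opprD opprK addrA subrr add0r normrZ.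
  by rewrite normrM normfV normr_id divfK ?normr_eq0// ger0_norm// ltW.
rewrite eq_sym -subr_eq0 addrAC subrr add0r oppr_eq0 scaler_eq0 (negbTE w0) orbF.
by rewrite mulf_neq0// ?invr_eq0 ?normr_eq0// gt_eqF.
Qed.

End HolderNorms.

(** * Hölder norms on the manifold *)

Section HolderNormsOnManifolds.
Context {R : realType} {n : nat} {M : closedManifold R n}.
Hypothesis n0 : (0 < n)%N.
Implicit Types (u : M -> R) (p : M).

Lemma cov_ball_two_points (k : 'I_(cov_size (cover_of M))) :
  exists x y, [/\ cov_ball k x, cov_ball k y & x != y].
Proof. exact/closed_ball_two_points/cov_radius_gt0. Qed.

Lemma holder_norm_ball m th u (k : 'I_(cov_size (cover_of M))) :
  (holder_norm_on m th (cov_ball k) (in_chart (cov_chart k) u)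
   <= holder_norm m th u)%E.
Proof.
rewrite /holder_norm (bigD1 k)//=; apply: leeDl; apply: sume_ge0 => j _.
by apply: holder_norm_on_ge0; exact: cov_ball_two_points.
Qed.

Lemma holder_norm_le m th u (D : R) :
  (forall k : 'I_(cov_size (cover_of M)),
    (holder_norm_on m th (cov_ball k) (in_chart (cov_chart k) u) <= D%:E)%E) ->
  (holder_norm m th u <= ((cov_size (cover_of M))%:R * D)%:E)%E.
Proof.
move=> hD; rewrite /holder_norm.
apply: (@le_trans _ _ (\sum_(k < cov_size (cover_of M)) D%:E)%E).
  by apply: lee_sum => k _; exact: hD.
by rewrite sumEFin big_const_ord iter_addr addr0 mulr_natl.
Qed.

Lemma holder_norm1_sup th u (D : R) p : (holder_norm 1 th u <= D%:E)%E ->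
  `|u p| <= D.
Proof.
move=> uD; have [_ pb] := chart_atP p; rewrite -lee_fin.
apply: le_trans (le_trans (holder_norm_ball _ _ _ (cov_at p)) uD).
apply: le_trans (holder_norm_on1_ub _ _ (cov_ball_two_points _) pb).
by rewrite lee_fin -/(chart_at p) in_chart_at lerDl sumr_ge0.
Qed.

Lemma holder_norm1_lipschitz th u (D : R) (k : 'I_(cov_size (cover_of M))) x y :
  Ck 1 u -> (holder_norm 1 th u <= D%:E)%E -> cov_ball k x -> cov_ball k y ->
  `|in_chart (cov_chart k) u x - in_chart (cov_chart k) u y| <= D * `|x - y|.
Proof.
move=> Cu uD; apply: closed_ball_lipschitz (Cu _) _ _ _.
- exact: chart_cod_open.
- exact: cov_radius_gt0.
- exact: cov_sub.
move=> z kz; rewrite -lee_fin.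
apply: le_trans (le_trans (holder_norm_ball _ _ _ k) uD).
apply: le_trans (holder_norm_on1_ub _ _ (cov_ball_two_points _) kz).
by rewrite lee_fin lerDr.
Qed.

Lemma holder_norm1_cst th (c : R) :
  (holder_norm 1 th (cst c : M -> R) <= ((cov_size (cover_of M))%:R * `|c|)%:E)%E.
Proof.
by apply: holder_norm_le => k; apply: holder_norm_on1_cst; exact: cov_ball_two_points.
Qed.

Lemma holder_norm0_interpolation th u (s K rho : R) :
  0 < th -> th < 1 -> 0 <= K -> 0 < rho -> (forall p, `|u p| <= s) ->
  (forall (k : 'I_(cov_size (cover_of M))) x y, cov_ball k x -> cov_ball k y ->
    `|in_chart (cov_chart k) u x - in_chart (cov_chart k) u y| <= K * `|x - y|) ->
  (holder_norm 0 th u <= ((cov_size (cover_of M))%:R *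
    (s + (K * rho `^ (1 - th) + 2 * s * (rho `^ th)^-1)))%:E)%E.
Proof.
move=> th0 th1 K0 rho0 us uK; apply: holder_norm_le => k.
by apply: holder_norm_on0_interpolation => // [x _|x y]; [exact: us|exact: uK].
Qed.

End HolderNormsOnManifolds.

(** * The factor 1 - q v for constant u, and its Lipschitz bounds *)

Section Damping.
Context {R : realType}.
Variables q m : R.
Hypotheses (q0 : 0 < q) (m0 : 0 < m).

(* The value of [1 - q v] when [u] is the constant [s] and [v] solves the second
   equation. *)
Definition damping (s : R) : R := m ^+ 2 / (m ^+ 2 + q ^+ 2 * s ^+ 2).

(** A Lipschitz constant of the square of [damping]: the factor 2 bounds the sum of two values, and
    q/m is a Lipschitz constant of [damping] itself. *)
Definition damping_rate : R := 2 * (q / m).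

Let den_gt0 s : 0 < m ^+ 2 + q ^+ 2 * s ^+ 2.
Proof. by rewrite ltr_wpDr ?exprn_gt0// mulr_ge0 ?sqr_ge0. Qed.

Lemma damping_gt0 s : 0 < damping s.
Proof. by rewrite divr_gt0 ?exprn_gt0. Qed.

Lemma damping_le1 s : damping s <= 1.
Proof. by rewrite ler_pdivrMr// mul1r lerDl mulr_ge0 ?sqr_ge0. Qed.

Lemma damping_lt1 s : 0 < s -> damping s < 1.
Proof.
by move=> s0; rewrite ltr_pdivrMr// mul1r ltrDl mulr_gt0 ?exprn_gt0.
Qed.

Lemma damping_sqr_le1 s : damping s ^+ 2 <= 1.
Proof. by rewrite expr_le1 ?damping_le1// ltW ?damping_gt0. Qed.

Lemma damping_anti s t : 0 <= s -> s <= t -> damping t <= damping s.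
Proof.
move=> s0 st; rewrite ler_pM2l ?exprn_gt0// lef_pV2 ?posrE//.
by rewrite lerD2l ler_wpM2l ?sqr_ge0// lerXn2r ?nnegrE// (le_trans s0).
Qed.

(** The difference factors as (q/m)(t - s) times two products. Each is at most 1/2, since m q |x| is
    at most half of m^2 + q^2 x^2 and the other factor is a value of [damping]. *)
Lemma damping_lipschitz s t : `|damping s - damping t| <= q / m * `|s - t|.
Proof.
pose D x := m ^+ 2 + q ^+ 2 * x ^+ 2.
have D0 x : 0 < D x by exact: den_gt0.
have half x : m * q * `|x| / D x <= 2^-1.
  rewrite ler_pdivrMr// /D -(real_normK (num_real x)).
  by have := sqr_ge0 (m - q * `|x|); rewrite !expr2; nra.
have -> : damping s - damping t =
    q / m * ((t - s) * ((m * q * t / D t) * (m ^+ 2 / D s)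
                        + (m * q * s / D s) * (m ^+ 2 / D t))).
  by rewrite /damping /D; field; rewrite !exprMn !gt_eqF ?den_gt0.
have qm : 0 <= q / m by rewrite divr_ge0// ltW.
rewrite normrM (ger0_norm qm) ler_wpM2l//.
rewrite normrM distrC ler_piMr//; apply: le_trans (ler_normD _ _) _.
have term x y : `|m * q * x / D x * (m ^+ 2 / D y)| <= 2^-1.
  have -> : `|m * q * x / D x * (m ^+ 2 / D y)| = m * q * `|x| / D x * damping y.
    rewrite !normrM !normfV (gtr0_norm m0) (gtr0_norm q0) !(gtr0_norm (D0 _)).
    by [].
  apply: le_trans (half x); rewrite ler_piMr ?damping_le1//.
  by rewrite divr_ge0 ?mulr_ge0 ?(ltW q0) ?(ltW m0) ?(ltW (D0 _)).
by apply: le_trans (lerD (term _ _) (term _ _)) _; lra.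
Qed.

Lemma damping_sqr_lipschitz s t :
  `|damping s ^+ 2 - damping t ^+ 2| <= damping_rate * `|s - t|.
Proof.
rewrite subr_sqr normrM mulrC /damping_rate -mulrA.
apply: ler_pM => //; last exact: damping_lipschitz.
have := damping_gt0 s; have := damping_gt0 t.
have := damping_le1 s; have := damping_le1 t => t1 s1 t0 s0.
by rewrite gtr0_norm; lra.
Qed.

Lemma damping_rate_gt0 : 0 < damping_rate.
Proof. by rewrite mulr_gt0// divr_gt0. Qed.

End Damping.

(** * Truncation at zero *)

Section Maximum0.
Context {R : realDomainType}.
Implicit Types x y : R.

Lemma dist_max0 x y : `|Num.max 0 x - Num.max 0 y| <= `|x - y|.
Proof.
case: (leP 0 x) => x0; case: (leP 0 y) => y0; rewrite ?subrr ?normr0 ?subr0 ?sub0r//.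
- by rewrite (ger0_norm x0) ger0_norm; lra.
- by rewrite normrN (ger0_norm y0) ler0_norm; lra.
Qed.

End Maximum0.

(** * Attained suprema and infima *)

Section Extrema.
Context {R : realType} {T : Type}.
Implicit Types (u : T -> R) (p : T).

Lemma sup_range_max u p : (forall p', u p' <= u p) -> sup (range u) = u p.
Proof.
move=> up; apply/eqP; rewrite eq_le; apply/andP; split.
  by apply: ge_sup; [exists (u p); exists p|move=> _ [p' _ <-]].
by apply: ub_le_sup; [exists (u p) => _ [p' _ <-]|exists p].
Qed.

Lemma inf_range_min u p : (forall p', u p <= u p') -> inf (range u) = u p.
Proof.
move=> up; apply/eqP; rewrite eq_le; apply/andP; split.
  by apply: ge_inf; [exists (u p) => _ [p' _ <-]|exists p].
by apply: lb_le_inf; [exists (u p); exists p|move=> _ [p' _ <-]].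
Qed.

End Extrema.

(** * Comparison of a power with its tangent-type linear bound below the level T *)

Section PowerGap.
Context {R : realType}.
Variables (e W : R).
Hypotheses (e0 : 0 < e) (e2 : e <= 2) (W1 : 1 <= W).

Definition level : R := W `^ e^-1.

Lemma level_ge1 : 1 <= level.
Proof.
rewrite -[leLHS](powRr0 W); apply: ler_powR => //.
by rewrite invr_ge0 ltW.
Qed.

Lemma level_gt0 : 0 < level.
Proof. exact: lt_le_trans level_ge1. Qed.

Lemma level_powR : level `^ e = W.
Proof.
by rewrite -powRrM mulVf ?gt_eqF// powRr1// (le_trans ler01).
Qed.

Lemma level_le x : 0 < x -> W <= x `^ e -> level <= x.
Proof.
move=> x0 Wx; rewrite leNgt; apply/negP => xT.
have := @gt0_ltr_powR R e e0 x level; rewrite !nnegrE level_powR.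
by move=> /(_ (ltW x0) (ltW level_gt0) xT); rewrite ltNge Wx.
Qed.

Lemma le_level x : 0 < x -> x `^ e <= W -> x <= level.
Proof.
move=> x0 Wx; rewrite leNgt; apply/negP => xT.
have := @gt0_ltr_powR R e e0 level x; rewrite !nnegrE level_powR.
by move=> /(_ (ltW level_gt0) (ltW x0) xT); rewrite ltNge Wx.
Qed.

(** With y = x/T at most 1, [e <= 2] gives y^e >= y^2, so the left side is at most W (1 - y^2) <= 2
    W (1 - y). Finally 1 - y <= T (1 - y) = T - x because T >= 1. *)
Lemma powR_gap x : 0 < x -> x <= level -> W - x `^ e <= 2 * W * (level - x).
Proof.
move=> x0 xT; have T0 := level_gt0; have T1 := level_ge1.
pose y := x / level.
have y0 : 0 < y by rewrite divr_gt0.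
have y1 : y <= 1 by rewrite ler_pdivrMr// mul1r.
have xE : x = level * y by rewrite mulrC divfK ?gt_eqF.
have xe : W * y ^+ 2 <= x `^ e.
  rewrite xE powRM ?(ltW T0) ?(ltW y0)// level_powR ler_wpM2l ?(le_trans ler01)//.
  by rewrite -powR_mulrn ?(ltW y0)// ger_powR// y0.
have gap : 1 - y <= level - x.
  by rewrite xE -[X in _ <= X - _]mulr1 -mulrBr ler_peMl// subr_ge0.
have : W * (2 * (1 - y)) <= W * (2 * (level - x)).
  by rewrite ler_wpM2l ?(le_trans ler01)// ler_wpM2l.
have : W * (1 - y ^+ 2) <= W * (2 * (1 - y)).
  rewrite ler_wpM2l ?(le_trans ler01)//.
  by have := sqr_ge0 (1 - y); rewrite !expr2; lra.
by move: xe; lra.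
Qed.

End PowerGap.

(** * The potential, its bounds and its Lipschitz estimates *)

Section Potential.
Context {R : realType} {T : Type}.
Variables (q m W : R).
Hypotheses (q0 : 0 < q) (m0 : 0 < m) (W1 : 1 <= W).
Implicit Types (w : R) (u : T -> R) (p : T).

(** In the uniqueness argument, 2W absorbs the bound of [powR_gap], the last term absorbs the
    variation of the squared damping, and the 1 is the surplus forcing maximum and minimum to
    agree. *)
Definition potential_slope w : R := 2 * W + 1 + w ^+ 2 * damping_rate q m.

(** Written with [sup] and [inf] so as to be defined for every function; they are the maximum and
    minimum once these are attained. *)
Definition prepotential w u p : R :=
  W + w ^+ 2 * damping q m (inf (range u)) ^+ 2
  - potential_slope w * (sup (range u) - u p).

Definition potential w u p : R := Num.max 0 (prepotential w u p).

Lemma potential_slope_gt0 w : 0 < potential_slope w.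
Proof.
have := damping_rate_gt0 q0 m0 => r0; have w2 := sqr_ge0 w.
have := mulr_ge0 w2 (ltW r0); rewrite /potential_slope.
by move: W1 (w ^+ 2 * _) => W1' x x0; lra.
Qed.

Lemma potential_ge0 w u p : 0 <= potential w u p.
Proof. by rewrite le_max lexx. Qed.

Lemma potential_max w u p : (forall p', u p' <= u p) ->
  potential w u p = W + w ^+ 2 * damping q m (inf (range u)) ^+ 2.
Proof.
move=> up; rewrite /potential /prepotential (sup_range_max up) subrr mulr0 subr0.
have W0 : 0 <= W := le_trans ler01 W1.
by apply: max_r; rewrite addr_ge0// mulr_ge0 ?sqr_ge0.
Qed.

Lemma potential_max_ge w u p : (forall p', u p' <= u p) -> W <= potential w u p.
Proof. by move=> up; rewrite potential_max// lerDl mulr_ge0 ?sqr_ge0. Qed.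

Lemma potential_le w u p pmax : (forall p', u p' <= u pmax) ->
  potential w u p <= W + w ^+ 2.
Proof.
move=> up; have W0 : 0 <= W by rewrite (le_trans ler01).
rewrite ge_max addr_ge0 ?sqr_ge0//= /prepotential (sup_range_max up).
rewrite -[leRHS]subr0 lerB//; last first.
  by rewrite mulr_ge0 ?(ltW (potential_slope_gt0 w))// subr_ge0.
by rewrite lerD2l ler_piMr ?sqr_ge0// damping_sqr_le1.
Qed.

Lemma potential_lipschitz w u p p' :
  `|potential w u p - potential w u p'| <= potential_slope w * `|u p - u p'|.
Proof.
apply: le_trans (dist_max0 _ _) _.
have -> : prepotential w u p - prepotential w u p' =
    potential_slope w * (u p - u p') by rewrite /prepotential; ring.
by rewrite normrM gtr0_norm// potential_slope_gt0.
Qed.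

(** Joint local Lipschitz bound in the parameter and in the sup norm of the function. It rests on
    the fact that a uniform perturbation of size [d] moves the maximum and the minimum by at most
    [d]. *)
Lemma potential_dist w w' u u' (d D : R) p pmax pmax' pmin pmin' :
  (forall p, u p <= u pmax) -> (forall p, u' p <= u' pmax') ->
  (forall p, u pmin <= u p) -> (forall p, u' pmin' <= u' p) ->
  (forall p, `|u p| <= D) -> (forall p, `|u' p - u p| <= d) ->
  d <= 1 -> `|w' - w| <= d ->
  `|potential w' u' p - potential w u p| <=
  d * ((2 * `|w| + 1) * (1 + damping_rate q m * (2 * D + 2))
       + w ^+ 2 * damping_rate q m + 2 * potential_slope w).
Proof.
move=> uM uM' um um' uD ud d1 wd; apply: le_trans (dist_max0 _ _) _.
have d0 : 0 <= d by apply: le_trans wd.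
have D0 : 0 <= D by apply: le_trans (uD p).
have r0 := damping_rate_gt0 q0 m0; set r := damping_rate q m in r0 *.
rewrite /prepotential (sup_range_max uM) (sup_range_max uM').
rewrite (inf_range_min um) (inf_range_min um').
have ud' x : u' x - d <= u x /\ u x <= u' x + d.
  by have := ud x; rewrite ler_norml => /andP[? ?]; split; lra.
have dM : `|u' pmax' - u pmax| <= d.
  rewrite ler_norml; have [a b] := ud' pmax'; have [a' b'] := ud' pmax.
  by have := uM pmax'; have := uM' pmax => *; apply/andP; split; lra.
have dm : `|u' pmin' - u pmin| <= d.
  rewrite ler_norml; have [a b] := ud' pmin'; have [a' b'] := ud' pmin.
  by have := um pmin'; have := um' pmin => *; apply/andP; split; lra.
have osc : `|u' pmax' - u' p| <= 2 * D + 2.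
  have := uD pmax'; have := uD p; rewrite !ler_norml => /andP[? ?] /andP[? ?].
  have [? ?] := ud' p; have [? ?] := ud' pmax'.
  by apply/andP; split; lra.
have dosc : `|(u' pmax' - u pmax) - (u' p - u p)| <= 2 * d.
  by apply: le_trans (ler_normB _ _) _; have := ud p; lra.
have w2 : `|w' ^+ 2 - w ^+ 2| <= d * (2 * `|w| + 1).
  rewrite subr_sqr normrM ler_pM//.
  have -> : w' + w = (w' - w) + 2 * w by ring.
  apply: le_trans (ler_normD _ _) _; rewrite normrM ger0_norm//; lra.
(* The difference is telescoped into four terms, each varying one ingredient: the parameter, the
   minimum, the parameter in the slope, and the oscillation. *)
have -> : W + w' ^+ 2 * damping q m (u' pmin') ^+ 2
    - potential_slope w' * (u' pmax' - u' p)
    - (W + w ^+ 2 * damping q m (u pmin) ^+ 2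
       - potential_slope w * (u pmax - u p)) =
  (w' ^+ 2 - w ^+ 2) * damping q m (u' pmin') ^+ 2
  + w ^+ 2 * (damping q m (u' pmin') ^+ 2 - damping q m (u pmin) ^+ 2)
  - ((w' ^+ 2 - w ^+ 2) * r * (u' pmax' - u' p)
     + potential_slope w * ((u' pmax' - u pmax) - (u' p - u p))).
  by rewrite /potential_slope -/r; ring.
apply: le_trans (ler_normB _ _) _.
apply: le_trans (lerD (ler_normD _ _) (ler_normD _ _)) _.
have t1 : `|(w' ^+ 2 - w ^+ 2) * damping q m (u' pmin') ^+ 2|
    <= d * (2 * `|w| + 1) * 1.
  rewrite normrM ler_pM//.
  by rewrite ger0_norm ?sqr_ge0// damping_sqr_le1.
have t2 : `|w ^+ 2 * (damping q m (u' pmin') ^+ 2 - damping q m (u pmin) ^+ 2)|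
    <= w ^+ 2 * (r * d).
  rewrite normrM ger0_norm ?sqr_ge0// ler_wpM2l ?sqr_ge0//.
  apply: le_trans (damping_sqr_lipschitz q0 m0 _ _) _.
  by rewrite ler_wpM2l// ltW.
have t3 : `|(w' ^+ 2 - w ^+ 2) * r * (u' pmax' - u' p)|
    <= d * (2 * `|w| + 1) * r * (2 * D + 2).
  rewrite (normrM _ (u' pmax' - u' p)) (normrM _ r) (gtr0_norm r0) ler_pM//.
    by rewrite mulr_ge0// ltW.
  by rewrite ler_wpM2r// ltW.
have t4 : `|potential_slope w * ((u' pmax' - u pmax) - (u' p - u p))|
    <= potential_slope w * (2 * d).
  rewrite normrM gtr0_norm ?potential_slope_gt0// ler_wpM2l//.
  by rewrite ltW ?potential_slope_gt0.
apply: le_trans (lerD (lerD t1 t2) (lerD t3 t4)) _.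
by rewrite le_eqVlt; apply/orP; left; apply/eqP; ring.
Qed.

End Potential.

(** * The constant solution and its uniqueness *)

Section EquilibriumUniqueness.
Context {R : realType} {n : nat} {M : closedManifold R n}.
Variables (g : riemannianMetric M) (q m W : R).
Hypotheses (q0 : 0 < q) (m0 : 0 < m) (W1 : 1 <= W) (n5 : (5 <= n)%N).
Implicit Types (u v : M -> R) (p : M).

(** Equals 4/(n - 2); dividing the first equation by u leaves u^e. *)
Let e : R := @two_star R n - 2.

Let nR : 5 <= n%:R :> R.
Proof. by rewrite (ler_nat R 5 n). Qed.

Lemma critical_exponent_gt0 : 0 < e.
Proof.
have n2 : 0 < n%:R - 2 :> R by move: nR => ?; lra.
by rewrite /e /two_star subr_gt0 ltr_pdivlMr//; lra.
Qed.

Lemma critical_exponent_le2 : e <= 2.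
Proof.
have n2 : 0 < n%:R - 2 :> R by move: nR => ?; lra.
by rewrite /e /two_star lerBlDr ler_pdivrMr//; move: nR => ?; lra.
Qed.

Let e0 := critical_exponent_gt0.
Let e2 := critical_exponent_le2.

Definition equilibrium : R := level e W.
(** This is q T^2 / (m^2 + q^2 T^2), the constant solving the second equation for u = T. *)
Definition equilibrium_field : R := (1 - damping q m equilibrium) / q.

Lemma equilibrium_gt0 : 0 < equilibrium.
Proof. exact: level_gt0. Qed.

Let powR_critical x : 0 < x -> x `^ (@two_star R n - 1) = x `^ e * x.
Proof.
move=> x0; have -> : @two_star R n - 1 = e + 1 by rewrite /e; ring.
rewrite powRD; last by apply/implyP => _; rewrite gt_eqF.
by rewrite powRr1// ltW.
Qed.

(** The maximum principle at the extrema of [v] compares 1 - q v with the damping of [u] there, and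
    monotonicity replaces that value of [u] by [a] or [b]. With a = b the bounds determine [v],
    which settles the case of constant [u]. *)
Lemma field_bounds u v (a b : R) : Ck 2 v -> 0 <= a ->
  (forall p, a <= u p) -> (forall p, u p <= b) ->
  (forall p, laplace_beltrami g v p + (m ^+ 2 + q ^+ 2 * u p ^+ 2) * v p =
     q * u p ^+ 2) ->
  forall p, damping q m b <= 1 - q * v p /\ 1 - q * v p <= damping q m a.
Proof.
move=> Cv a0 au ub eqv p; have cv := Ck_continuous Cv.
have [[pm vm] [pM vM]] := extrema_exist cv.
have den_gt0 s : 0 < m ^+ 2 + q ^+ 2 * s ^+ 2.
  by rewrite ltr_wpDr ?exprn_gt0// mulr_ge0 ?sqr_ge0.
have dampingE s : damping q m s * (m ^+ 2 + q ^+ 2 * s ^+ 2) = m ^+ 2.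
  by rewrite divfK// gt_eqF.
split.
- have lapM : 0 <= laplace_beltrami g v pM.
    rewrite -oppr_le0 -mulN1r; apply: laplace_beltrami_extremum => //.
    by move=> p'; rewrite !mulN1r lerN2.
  apply: (@le_trans _ _ (damping q m (u pM))).
    by apply: damping_anti => //; apply: le_trans (au _).
  apply: (@le_trans _ _ (1 - q * v pM)); last by rewrite lerD2l lerN2 ler_pM2l.
  rewrite -(ler_pM2r (den_gt0 (u pM))) dampingE.
  have : (m ^+ 2 + q ^+ 2 * u pM ^+ 2) * v pM <= q * u pM ^+ 2.
    by rewrite -(eqv pM) lerDr.
  by move=> /(ler_wpM2l (ltW q0)); lra.
have lapm : laplace_beltrami g v pm <= 0.
  rewrite -[X in X <= _]mul1r; apply: laplace_beltrami_extremum => //.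
  by move=> p'; rewrite !mul1r.
apply: (@le_trans _ _ (damping q m (u pm))); last exact: damping_anti.
apply: (@le_trans _ _ (1 - q * v pm)); first by rewrite lerD2l lerN2 ler_pM2l.
rewrite -(ler_pM2r (den_gt0 (u pm))) dampingE.
have : q * u pm ^+ 2 <= (m ^+ 2 + q ^+ 2 * u pm ^+ 2) * v pm.
  by rewrite -(eqv pm) gerDr.
by move=> /(ler_wpM2l (ltW q0)); lra.
Qed.

Lemma equilibrium_solution w : is_positive_solution g q m w
  (potential q m W w (cst equilibrium : M -> R))
  (cst equilibrium) (cst equilibrium_field).
Proof.
have T0 := equilibrium_gt0; have dT := damping_lt1 q0 m0 T0.
have qv : q * equilibrium_field = 1 - damping q m equilibrium.
  by rewrite /equilibrium_field mulrC divfK// gt_eqF.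
split=> p /=.
- exact: T0.
- by rewrite divr_gt0// subr_gt0.
- rewrite laplace_beltrami_cst add0r powR_critical// level_powR//.
  (* For constant u every point is both a maximum and a minimum, so the potential is W + w^2
     r(T)^2. *)
  rewrite potential_max// (@inf_range_min _ _ _ p)// qv opprB addrCA subrr addr0.
  by rewrite mulrDl.
- rewrite laplace_beltrami_cst add0r /equilibrium_field /damping.
  have d0 : 0 < m ^+ 2 + q ^+ 2 * equilibrium ^+ 2.
    by rewrite ltr_wpDr ?exprn_gt0// mulr_ge0 ?sqr_ge0.
  by field; rewrite exprMn !gt_eqF.
Qed.

Lemma equilibrium_unique w u v : Ck 2 u -> Ck 2 v ->
  is_positive_solution g q m w (potential q m W w u) u v ->
  u = cst equilibrium /\ v = cst equilibrium_field.
Proof.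
move=> Cu Cv [u0 v0 equ eqv]; have cu := Ck_continuous Cu.
have [[pm um] [pM uM]] := extrema_exist cu.
set T := equilibrium.
pose d := damping q m.
have bounds := field_bounds Cv (ltW (u0 pm)) um uM eqv.
have T0 : 0 < T by exact: equilibrium_gt0.
have w2 := sqr_ge0 w.
have TM : T <= u pM.
  apply: level_le => //.
  have lapM : 0 <= laplace_beltrami g u pM.
    rewrite -oppr_le0 -mulN1r; apply: laplace_beltrami_extremum => //.
    by move=> p'; rewrite !mulN1r lerN2.
  have : potential q m W w u pM * u pM <=
      (u pM `^ e + w ^+ 2 * (1 - q * v pM) ^+ 2) * u pM.
    by rewrite mulrDl -powR_critical// -equ lerDr.
  rewrite ler_pM2r// potential_max// (inf_range_min um) => h.
  (* The bound 1 - q v <= r(m) makes the two terms in w^2 compare in the right direction, leaving W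
     <= A^e. *)
  rewrite -(lerD2r (w ^+ 2 * d (u pm) ^+ 2)); apply: le_trans h _.
  rewrite lerD2l ler_wpM2l// lerXn2r ?nnegrE//.
  + by apply: le_trans (bounds pM).1; exact: ltW (damping_gt0 _ _ _).
  + exact: ltW (damping_gt0 _ _ _).
  + by have [] := bounds pM.
have gap : u pm `^ e + w ^+ 2 * d (u pM) ^+ 2 <=
    W + w ^+ 2 * d (u pm) ^+ 2 - potential_slope q m W w * (u pM - u pm).
  have lapm : laplace_beltrami g u pm <= 0.
    rewrite -[X in X <= _]mul1r; apply: laplace_beltrami_extremum => //.
    by move=> p'; rewrite !mul1r.
  have : (u pm `^ e + w ^+ 2 * (1 - q * v pm) ^+ 2) * u pm <=
      potential q m W w u pm * u pm.
    by rewrite mulrDl -powR_critical// -equ gerDr.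
  rewrite ler_pM2r// => h1.
  have h2 : u pm `^ e + w ^+ 2 * d (u pM) ^+ 2 <= potential q m W w u pm.
    apply: le_trans h1; rewrite lerD2l ler_wpM2l// lerXn2r ?nnegrE//.
    + exact: ltW (damping_gt0 _ _ _).
    + by apply: le_trans (bounds pm).1; exact: ltW (damping_gt0 _ _ _).
    + by have [] := bounds pm.
  (* Positivity rules out the value 0 of the truncation, so the inequality holds for the
     [prepotential]. *)
  have pos : 0 < u pm `^ e + w ^+ 2 * d (u pM) ^+ 2.
    by rewrite ltr_wpDr ?powR_gt0// mulr_ge0 ?sqr_ge0.
  move: h2; rewrite /potential le_max leNgt pos /=.
  by rewrite /prepotential (sup_range_max uM) (inf_range_min um).
have dlip : w ^+ 2 * (d (u pm) ^+ 2 - d (u pM) ^+ 2) <=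
    w ^+ 2 * damping_rate q m * (u pM - u pm).
  rewrite -mulrA ler_wpM2l//; apply: le_trans (ler_norm _) _.
  apply: le_trans (damping_sqr_lipschitz q0 m0 _ _) _.
  by rewrite distrC ger0_norm// subr_ge0.
have {gap dlip} gap : (2 * W + 1) * (u pM - u pm) <= W - u pm `^ e.
  by move: gap dlip; rewrite /potential_slope; lra.
have mM : u pm <= u pM by [].
have W0 : 0 <= W := le_trans ler01 W1.
have eqmM : u pM = u pm.
  apply/eqP; rewrite eq_le mM andbT -subr_le0.
  (* If m <= T, [powR_gap] and T <= A bound the right side of [gap] by 2W (A - m); otherwise that
     side is nonpositive. Both cases leave A - m <= 0. *)
  have [mT|Tm] := leP (u pm) T.
    have h : W - u pm `^ e <= 2 * W * (T - u pm).
      exact (powR_gap e0 e2 W1 (u0 pm) mT).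
    have : 2 * W * (T - u pm) <= 2 * W * (u pM - u pm).
      by rewrite ler_wpM2l ?mulr_ge0// lerB.
    by move: gap h; rewrite mulrDl mul1r; lra.
  have h : W <= u pm `^ e.
    rewrite -[leLHS](level_powR e0 W1).
    by rewrite ge0_ler_powR ?nnegrE// ltW// equilibrium_gt0.
  have : 0 <= 2 * W * (u pM - u pm) by rewrite !mulr_ge0// subr_ge0.
  by move: gap h; rewrite mulrDl mul1r; lra.
have mT : u pm <= T.
  by apply: le_level => //; rewrite -subr_ge0; move: gap; rewrite eqmM subrr mulr0.
have uT p : u p = T.
  apply/eqP; rewrite eq_le; apply/andP; split.
    by rewrite (le_trans (uM p))// eqmM.
  by rewrite (le_trans TM)// eqmM.
split; apply/funext => p; first exact: uT.
have Tu p' : T <= u p' by rewrite uT.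
have uT' p' : u p' <= T by rewrite uT.
have [lo hi] := field_bounds Cv (ltW T0) Tu uT' eqv p.
have : 1 - q * v p = damping q m T by apply/eqP; rewrite eq_le hi lo.
by rewrite /equilibrium_field -/T => <-; rewrite subKr mulrC mulKf// gt_eqF.
Qed.

End EquilibriumUniqueness.

(** * The potential as a continuous map between Hölder spaces *)

Section PotentialMap.
Context {R : realType} {n : nat} {M : closedManifold R n}.
Variables (q m W th : R).
Hypotheses (q0 : 0 < q) (m0 : 0 < m) (W1 : 1 <= W) (n0 : (0 < n)%N).
Hypotheses (th0 : 0 < th) (th1 : th < 1).
Implicit Types (u : M -> R) (p : M) (w : R).

Lemma holder_space1_bound u : holder_space 1 th u ->
  exists2 D : R, 0 <= D & (holder_norm 1 th u <= D%:E)%E.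
Proof.
move=> [_ fin].
case E : (holder_norm 1 th u) fin => [D| |] // _.
  exists D => //; apply: le_trans (normr_ge0 (u point)) _.
  by apply: (holder_norm1_sup n0 (th := th)); rewrite E.
by exists 0; rewrite ?leNye.
Qed.

Lemma potential_holder w u : holder_space 1 th u ->
  holder_space 0 th (potential q m W w u).
Proof.
move=> hu; have [Cu _] := hu; have [D D0 uD] := holder_space1_bound hu.
have [_ [pM uM]] := extrema_exist (Ck_continuous Cu).
split.
  move=> i; split => //; apply: within_continuous_open => [|x ix].
    exact: chart_cod_open.
  have cu := Ck_on_continuous (@chart_cod_open _ _ M i) (Cu i) ix.
  pose c := W + w ^+ 2 * damping q m (inf (range u)) ^+ 2.
  pose y x' := c - potential_slope q m W w * (sup (range u) - in_chart i u x').
  have cc (k : R) : {for x, continuous (fun _ : 'rV[R]_n => k)}.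
    exact: cst_continuous.
  have cy : {for x, continuous y}.
    exact: (continuousB (cc c) (continuousM (cc _) (continuousB (cc _) cu))).
  exact: (continuous_max (cc 0) cy).
have S0 := ltW (potential_slope_gt0 q0 m0 W1 w).
(* Only finiteness is at stake, so the interpolation scale is simply 1. *)
have norm_le := @holder_norm0_interpolation _ _ M th (potential q m W w u)
  (W + w ^+ 2) (potential_slope q m W w * D) 1 th0 th1.
apply: (@le_lt_trans _ _ _ _ _ (norm_le _ ltr01 _ _)); last exact: ltry.
- exact: mulr_ge0.
- move=> p; rewrite ger0_norm ?potential_ge0//.
  exact: (potential_le q0 m0 W1 _ _ uM).
move=> k x y kx ky; apply: le_trans (potential_lipschitz q0 m0 W1 _ _ _ _) _.
by rewrite -mulrA ler_wpM2l//; exact: (holder_norm1_lipschitz n0 Cu uD).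
Qed.

Lemma potential_continuous : continuous_holder_map th (potential q m W : R -> (M -> R) -> _).
Proof.
move=> w u hu eps eps0.
have [Cu _] := hu; have [D D0 uD] := holder_space1_bound hu.
pose N : R := (cov_size (cover_of M))%:R.
have N0 : 0 <= N by exact: ler0n.
pose S := potential_slope q m W.
have S0 w' : 0 <= S w' := ltW (potential_slope_gt0 q0 m0 W1 w').
(* A Lipschitz constant, on each covering ball, for the difference of the two potentials when the
   data are within distance 1. It does not become small, so [rho] is fixed first to bring its
   contribution below eps/2. *)
pose K := S (`|w| + 1) * (D + 1) + S w * D.
have K0 : 0 <= K by rewrite addr_ge0// mulr_ge0// addr_ge0.
pose rho := (eps / (2 * (N * K + 1))) `^ (1 - th)^-1.
have NK : 0 < N * K + 1 by rewrite ltr_wpDl// mulr_ge0.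
have rho0 : 0 < rho by rewrite powR_gt0// divr_gt0// mulr_gt0.
have rhoE : rho `^ (1 - th) = eps / (2 * (N * K + 1)).
  rewrite -powRrM mulVf ?subr_eq0 ?gt_eqF// powRr1// ltW//.
  by rewrite divr_gt0// mulr_gt0.
(* The constant of [potential_dist]: the potentials differ uniformly by at most [delta * E]. *)
pose E := (2 * `|w| + 1) * (1 + damping_rate q m * (2 * D + 2))
       + w ^+ 2 * damping_rate q m + 2 * S w.
have r0 := ltW (damping_rate_gt0 q0 m0).
have E0 : 0 <= E.
  have w1 : 0 <= 2 * `|w| + 1 by rewrite addr_ge0// mulr_ge0.
  have D2 : 0 <= 2 * D + 2 by rewrite addr_ge0// mulr_ge0.
  have rD : 0 <= 1 + damping_rate q m * (2 * D + 2) by rewrite addr_ge0// mulr_ge0.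
  apply: addr_ge0; last exact: mulr_ge0.
  by apply: addr_ge0; [exact: mulr_ge0|exact: mulr_ge0 (sqr_ge0 _) r0].
(* Collects what multiplies [delta] in the interpolated norm; [delta] is then taken so that
   [delta * F] is below eps/2. *)
pose F := N * (E * (1 + 2 * (rho `^ th)^-1)).
have F0 : 0 <= F.
  by rewrite !mulr_ge0// addr_ge0// mulr_ge0// invr_ge0 powR_ge0.
pose delta := Num.min 1 (eps / (2 * (F + 1))).
have F1 : 0 < F + 1 by rewrite ltr_wpDl.
have delta0 : 0 < delta by rewrite lt_min ltr01 divr_gt0// mulr_gt0.
have delta1 : delta <= 1 by rewrite ge_min lexx.
have deltaF : delta <= eps / (2 * (F + 1)) by rewrite ge_min lexx orbT.
exists delta => // w' u' [Cu' _] ww' /ltW uu'.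
have Cd : Ck 1 (u' \- u).
  move=> i; have oi := @chart_cod_open _ _ M i.
  have := Ck_onD oi (Cu' i) (Ck_onM oi (Ck_on_cst 1 _ (-1)) (Cu i)).
  by apply: Ck_on_eq => // x _; rewrite mulN1r.
have [[pm um] [pM uM]] := extrema_exist (Ck_continuous Cu).
have [[pm' um'] [pM' uM']] := extrema_exist (Ck_continuous Cu').
have sup_le p : `|(potential q m W w' u' \- potential q m W w u) p| <= delta * E.
  apply: (potential_dist q0 m0 W1 _ uM uM' um um') => //; last exact: ltW.
    by move=> p'; exact (holder_norm1_sup n0 p' uD).
  by move=> p'; exact (holder_norm1_sup n0 p' uu').
have norm_le := @holder_norm0_interpolation _ _ M th
  (potential q m W w' u' \- potential q m W w u) (delta * E) K rho
  th0 th1 K0 rho0 sup_le.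
apply: (@le_lt_trans _ _ _ _ _ (norm_le _)).
  move=> k x y kx ky.
  set a := in_chart _ _ x; set b := in_chart _ _ y.
  pose h' z := in_chart (cov_chart k) (potential q m W w' u') z.
  pose h z := in_chart (cov_chart k) (potential q m W w u) z.
  have -> : a - b = (h' x - h' y) - (h x - h y).
    by rewrite /a /b /h /h' /in_chart /=; ring.
  apply: le_trans (ler_normB _ _) _.
  rewrite /K mulrDl; apply: lerD; last first.
    apply: le_trans (potential_lipschitz q0 m0 W1 _ _ _ _) _.
    by rewrite -mulrA ler_wpM2l//; exact: (holder_norm1_lipschitz n0 Cu uD).
  apply: le_trans (potential_lipschitz q0 m0 W1 _ _ _ _) _.
  rewrite -mulrA; apply: ler_pM => //.
    rewrite /S /potential_slope lerD2l ler_wpM2r//.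
    rewrite -[w' ^+ 2](real_normK (num_real w')) lerXn2r ?nnegrE ?addr_ge0//.
    have -> : w' = w + (w' - w) by ring.
    apply: le_trans (ler_normD _ _) _; rewrite lerD2l.
    by apply: le_trans delta1; exact: ltW.
  (* The Lipschitz constant of [u'] is at most [D + 1]: [D] from [u], and [delta <= 1] from the
     difference. *)
  pose f' z := in_chart (cov_chart k) u' z; pose f z := in_chart (cov_chart k) u z.
  have -> : u' (chart_inv (cov_chart k) x) - u' (chart_inv (cov_chart k) y) =
      (f x - f y) + ((f' x - f x) - (f' y - f y)).
    by rewrite /f /f' /in_chart; ring.
  apply: le_trans (ler_normD _ _) _; rewrite mulrDl; apply: lerD.
    exact: (holder_norm1_lipschitz n0 Cu uD).
  apply: le_trans (holder_norm1_lipschitz n0 Cd uu' kx ky) _.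
  by rewrite ler_wpM2r.
rewrite lte_fin -/N.
have -> : N * (delta * E + (K * rho `^ (1 - th) + 2 * (delta * E) * (rho `^ th)^-1)) =
   delta * F + N * K * rho `^ (1 - th) by rewrite /F; ring.
rewrite [ltRHS](splitr eps); apply: ltrD.
  apply: le_lt_trans (ler_wpM2r F0 deltaF) _.
  rewrite mulrAC ltr_pdivrMr ?mulr_gt0//.
  have -> : eps / 2 * (2 * (F + 1)) = eps * F + eps by field.
  by rewrite ltrDl.
rewrite rhoE mulrA ltr_pdivrMr ?mulr_gt0//.
have -> : eps / 2 * (2 * (N * K + 1)) = N * K * eps + eps by field.
by rewrite ltrDl.
Qed.

End PotentialMap.

(** * Choice of W and verification of the required properties *)

Theorem proposition9p1 (R : realType) (n : nat) (hn : (5 <= n)%N)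
    (M : closedManifold R n) (g : riemannianMetric M)
    (q m0 m1 theta : R) (hq : 0 < q) (hm0 : 0 < m0) (hm1 : 0 < m1)
    (htheta0 : 0 < theta) (htheta1 : theta < 1) :
  exists h : R -> (M -> R) -> (M -> R),
    (forall (omega : R) (u : M -> R), holder_space 1 theta u ->
       holder_space 0 theta (h omega u)) /\
    continuous_holder_map theta h /\
    (* (i) *)
    (forall (omega : R) (u : M -> R), holder_space 1 theta u ->
       exists p, (n%:R - 2) / (4 * (n%:R - 1)) * scalar_curvature g p
                 < h omega u p) /\
    (* (ii) *)
    (forall (omega : R) (u : M -> R), holder_space 1 theta u ->
       (forall p, 0 <= h omega u p) /\ (exists p, h omega u p != 0)) /\
    (* (iii) *)
    (forall K : set R, compact K -> exists B : R,
       forall (omega : R) (u : M -> R), K omega -> holder_space 1 theta u ->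
       forall p, `|h omega u p| <= B) /\
    (* (iv) *)
    (forall omega, exists a b : R,
       is_positive_solution g q m1 omega (h omega (cst a)) (cst a) (cst b)) /\
    (forall beta : R, 0 < beta -> beta < 1 ->
       exists2 C : R, 0 < C &
       forall omega (u v : M -> R), Ck 2 u -> Ck 2 v ->
         is_positive_solution g q m1 omega (h omega u) u v ->
         (holder_norm 1 beta u + holder_norm 1 beta v <= C%:E)%E).
Proof.
have n0 : (0 < n)%N by exact: leq_trans hn.
pose cn : R := (n%:R - 2) / (4 * (n%:R - 1)).
have cn0 : 0 <= cn.
  have : (5 : R) <= n%:R by rewrite (ler_nat R 5 n).
  by move=> n5; rewrite divr_ge0//; lra.
have [C SC] := scalar_curvature_bounded g.
(* The summand 1 makes the curvature comparison in (i) strict; the maximum with 1 ensures T >= 1. *)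
pose W := Num.max 1 (cn * C + 1).
have W1 : 1 <= W by rewrite le_max lexx.
have SW p : cn * scalar_curvature g p < W.
  rewrite lt_max; apply/orP; right; apply: (@le_lt_trans _ _ (cn * C)).
    by rewrite ler_wpM2l.
  by rewrite ltrDl.
have argmax u : holder_space 1 theta u -> exists p : M, forall p', u p' <= u p.
  by move=> [/Ck_continuous/extrema_exist[]].
exists (potential q m1 W); split; [|split; [|split; [|split; [|split; [|split]]]]].
- by move=> w u; exact: potential_holder.
- exact: potential_continuous.
- move=> w u /argmax[p up]; exists p; apply: lt_le_trans (SW p) _.
  exact: potential_max_ge.
- move=> w u /argmax[p up]; split=> [p'|]; first exact: potential_ge0.
  exists p; rewrite gt_eqF//; apply: lt_le_trans (potential_max_ge q m1 W1 w up).
  exact: lt_le_trans ltr01 W1.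
(* Boundedness provides a bound by every number strictly above [B], whence the choice |B| + 1. *)
- move=> K /compact_bounded[B [_ KB]]; exists (W + (`|B| + 1) ^+ 2) => w u Kw /argmax[p up] p'.
  rewrite ger0_norm ?potential_ge0//.
  apply: le_trans (potential_le hq hm1 W1 w p' up) _.
  rewrite lerD2l -(real_normK (num_real w)) lerXn2r ?nnegrE ?addr_ge0//.
  by apply: KB => //; rewrite (le_lt_trans (ler_norm B))// ltrDl.
- move=> w; exists (@equilibrium R n W), (@equilibrium_field R n q m1 W).
  exact: equilibrium_solution.
- move=> beta beta0 beta1.
  pose N : R := (cov_size (cover_of M))%:R.
  (* Neither constant involves the parameter w, so the bound is uniform in it; the final constant
     [D + 1] is positive. *)
  pose D := N * `|@equilibrium R n W| + N * `|@equilibrium_field R n q m1 W|.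
  exists (D + 1); first by rewrite ltr_wpDl// addr_ge0// mulr_ge0// ler0n.
  move=> w u v Cu Cv /(equilibrium_unique hq hm1 W1 hn Cu Cv)[-> ->].
  apply: (@le_trans _ _ D%:E); last by rewrite lee_fin lerDl.
  by rewrite EFinD; apply: leeD; exact: holder_norm1_cst.
Qed.
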